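(* Let $(\widetilde{\mathfrak g},H_0)$ be a regular graded Lie algebra over $F$, with $\widetilde{\mathfrak g}=V^-\oplus\mathfrak g\oplus V^+$, and let $\lambda_0,\dots,\lambda_k$ be the roots produced by the descent. Then every element of $V^+$ is conjugate, under the group $\mathrm{Aut}_e(\mathfrak g)$, to an element of $\widetilde{\mathfrak g}^{\lambda_0}\oplus\cdots\oplus\widetilde{\mathfrak g}^{\lambda_k}$.
   Context: Setting. $F$ is a finite extension of $\mathbb Q_p$ whose residue field has characteristic $\neq 2$; $\overline F$ is an algebraic closure and $\overline U=U\otimes_F\overline F$. A regular graded Lie algebra is a reductive Lie algebra $\widetilde{\mathfrak g}$ over $F$ with an element $H_0$ such that (H1) $\widetilde{\mathfrak g}=V^-\oplus\mathfrak g\oplus V^+$ with $V^+\ne 0$, where $V^-,\mathfrak g,V^+$ are the eigenspaces of $\operatorname{ad}H_0$ for the eigenvalues $-2,0,2$; (H2) the bracket representation of $\mathfrak g$ on $\overline{V^+}$ is irreducible; (H3) there are $I^\pm\in V^\pm$ such that $(I^-,H_0,I^+)$ is an $\mathfrak{sl}_2$-triple. Convention: $(Y,H,X)$ is an $\mathfrak{sl}_2$-triple if $[H,X]=2X$, $[H,Y]=-2Y$, $[Y,X]=H$. Roots and descent. $\mathfrak a$ is a maximal split abelian subalgebra of $\mathfrak g$ containing $H_0$ (it is also maximal split abelian in $\widetilde{\mathfrak g}$); $\widetilde\Sigma$, $\Sigma$ are the root systems of $(\widetilde{\mathfrak g},\mathfrak a)$, $(\mathfrak g,\mathfrak a)$;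 $\widetilde{\mathfrak g}^\lambda$ is the root space of $\lambda$. One fixes a basis $\widetilde\Pi$ of $\widetilde\Sigma$ with $\nu(H_0)\in\{0,2\}$ for all $\nu\in\widetilde\Pi$; exactly one simple root, $\lambda_0$, satisfies $\lambda_0(H_0)=2$. Inductively, $\widetilde{\mathfrak l}_i$ is the subalgebra generated by $\widetilde{\mathfrak g}^{\lambda_i}$ and $\widetilde{\mathfrak g}^{-\lambda_i}$, $\widetilde{\mathfrak g}_j$ is the centralizer of $\widetilde{\mathfrak l}_0\oplus\dots\oplus\widetilde{\mathfrak l}_{j-1}$ in $\widetilde{\mathfrak g}$, $\widetilde\Sigma_j$ is the set of roots of $\widetilde\Sigma$ strongly orthogonal to $\lambda_0,\dots,\lambda_{j-1}$ (the root system of $\widetilde{\mathfrak g}_j$), ordered by $\widetilde\Sigma_j^+=\widetilde\Sigma^+\cap\widetilde\Sigma_j$, and $\lambda_j$ is the unique simple root of $\widetilde\Sigma_j^+$ with $\lambda_j(H_0)=2$. The process stops at the index $k$ for which the centralizer of $\widetilde{\mathfrak l}_0\oplus\dots\oplus\widetilde{\mathfrak l}_k$ meets $V^+$ in $0$. $\mathrm{Aut}_e(\mathfrak g)$ is the group of elementary automorphisms: finite products of $e^{\operatorname{ad}x}$ with $x\in\mathfrak g$ and $\operatorname{ad}x$ nilpotent on $\mathfrak g$; it acts on $\widetilde{\mathfrak g}$, hence on $V^+$, via $e^{\operatorname{ad}_{\widetilde{\mathfrak g}}x}$ ($x\in[\mathfrak g,\mathfrak g]$). *)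

(* Defs.v *)
From HB Require Import structures.
From mathcomp Require Import all_boot all_order all_algebra all_field.
Set Implicit Arguments.
Unset Strict Implicit.
Unset Printing Implicit Defensive.
Import Order.TTheory GRing.Theory Num.Theory.
Local Open Scope ring_scope.

(* |q|_p, as a rational number. *)
Definition padic_abs (p : nat) (q : rat) : rat :=
  if q == 0 then 0
  else p%:R ^+ logn p `|denq q|%N / p%:R ^+ logn p `|numq q|%N.

(* (K, N) is the completion of (rat, |.|_p), that is, K is Q_p and N is its
   p-adic absolute value.  The absolute value of Q_p only takes the values 0 and
   p ^ n with n an integer, hence the codomain rat. *)
Record is_Qp (p : nat) (K : fieldType) (N : K -> rat) : Prop := IsQp {
  Qp_prime : prime p;
  Qp_norm_eq0 : forall x, N x = 0 <-> x = 0;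
  Qp_normM : forall x y, N (x * y) = N x * N y;
  Qp_normD : forall x y, N (x + y) <= Num.max (N x) (N y);
  Qp_norm_rat : forall q : rat, N (ratr q) = padic_abs p q;
  Qp_dense : forall (x : K) (e : rat), 0 < e -> exists q : rat, N (x - ratr q) < e;
  Qp_complete : forall u : nat -> K,
    (forall e : rat, 0 < e -> exists n0 : nat, forall m n : nat,
       (n0 <= m)%N -> (n0 <= n)%N -> N (u m - u n) < e) ->
    exists l : K, forall e : rat, 0 < e -> exists n0 : nat, forall n : nat,
       (n0 <= n)%N -> N (u n - l) < e
}.

(* The valuation ring of a finite extension F of K = Q_p is the integral closure
   in F of the valuation ring {x | N x <= 1} of K. *)
Definition val_ring (K : fieldType) (N : K -> rat) (F : fieldExtType K) (x : F) : Prop :=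
  exists q : {poly K},
    [/\ q \is monic, forall i, N q`_i <= 1 & root (map_poly (in_alg F) q) x].

Definition val_max_ideal (K : fieldType) (N : K -> rat) (F : fieldExtType K) (x : F) : Prop :=
  val_ring N x /\ ~ exists y : F, val_ring N y /\ x * y = 1.

(* The residue field val_ring / val_max_ideal has characteristic l (l prime). *)
Definition residue_char (K : fieldType) (N : K -> rat) (F : fieldExtType K) (l : nat) : Prop :=
  prime l /\ val_max_ideal N (l%:R : F).

Definition is_algebraic_closure (F : fieldType) (Fbar : closedFieldType)
    (iota : {rmorphism F -> Fbar}) : Prop :=
  forall z : Fbar, algebraicOver iota z.

HB.mixin Record isLie (F : fieldType) L of Vector F L := {
  lie : L -> L -> L;
  lie_linearl : forall (a : F) (x y z : L), lie (a *: x + y) z = a *: lie x z + lie y z;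
  lie_linearr : forall (a : F) (x y z : L), lie x (a *: y + z) = a *: lie x y + lie x z;
  liexx : forall x : L, lie x x = 0;
  lie_jacobi : forall x y z : L,
    lie x (lie y z) + lie y (lie z x) + lie z (lie x y) = 0
}.

#[short(type="lieType")]
HB.structure Definition LieAlgebra (F : fieldType) := {L of isLie F L & Vector F L}.

Section LieTheory.
Context (F : fieldType) (L : lieType F).
Implicit Types (x y : L) (U A : {vspace L}).

HB.instance Definition _ x :=
  GRing.isLinear.Build F L L *:%R (lie x) (fun a y z => lie_linearr a x y z).

Definition ad x : 'End(L) := linfun (lie x).

Lemma adE x y : ad x y = lie x y.
Proof. by rewrite lfunE. Qed.

Definition is_subalgebra U : Prop := forall x y, x \in U -> y \in U -> lie x y \in U.

Definition is_ideal U : Prop := forall x y, y \in U -> lie x y \in U.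

(* The adjoint representation is semisimple. *)
Definition reductive : Prop :=
  forall U, is_ideal U ->
    exists U', [/\ is_ideal U', (U :&: U' = 0)%VS & (U + U' = fullv)%VS].

Definition derived U : {vspace L} :=
  <<[seq lie x y | x <- vbasis U, y <- vbasis U]>>%VS.

Definition generated (S : L -> Prop) x : Prop :=
  forall U, is_subalgebra U -> (forall y, S y -> y \in U) -> x \in U.

Definition centralizes (S : L -> Prop) x : Prop := forall y, S y -> lie x y = 0.

Definition sl2_triple (Y H X : L) : Prop :=
  [/\ lie H X = 2%:R *: X, lie H Y = - 2%:R *: Y & lie Y X = H].

Definition ad_diagonalizable x : Prop :=
  exists e : seq L, basis_of fullv e /\
    forall v, v \in e -> exists a : F, lie x v = a *: v.

(* Splitness of A, even inside a subalgebra U, is tested on the whole of L. *)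
Definition split_abelian A : Prop :=
  (forall x y, x \in A -> y \in A -> lie x y = 0) /\
  (forall x, x \in A -> ad_diagonalizable x).

Definition max_split_abelian U A : Prop :=
  [/\ (A <= U)%VS, split_abelian A &
      forall B, (A <= B)%VS -> (B <= U)%VS -> split_abelian B -> B = A].

(* The matrix (acting on row vectors) of ad x on a stable subspace U, in the
   basis vbasis U. *)
Definition ad_mx U x : 'M[F]_(\dim U) :=
  \matrix_(i, j) coord (vbasis U) j (lie x (vbasis U)`_i).

(* The extension of scalars of U along iota : F -> E is identified with
   'rV[E]_(\dim U) through vbasis U; W ranges over all its E-subspaces. *)
Definition irreducible_over (E : fieldType) (iota : {rmorphism F -> E}) (U V : {vspace L}) : Prop :=
  (0 < \dim V)%N /\
  forall W : 'M[E]_(\dim V),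
    (forall x, x \in U -> stablemx W (map_mx iota (ad_mx V x))) ->
    W = 0 \/ row_full W.

End LieTheory.

Section Grading.
Context (F : fieldType) (L : lieType F) (H0 : L).

Definition Vplus : {vspace L} := passmx.leigenspace (ad H0) 2%:R.
Definition Vminus : {vspace L} := passmx.leigenspace (ad H0) (- 2%:R).
Definition Vzero : {vspace L} := passmx.leigenspace (ad H0) 0.

Record regular_graded (Fbar : closedFieldType) (iota : {rmorphism F -> Fbar}) : Prop :=
  RegularGraded {
    rg_reductive : reductive L;
    rg_direct : directv (Vminus + Vzero + Vplus);
    rg_sum : (Vminus + Vzero + Vplus)%VS = fullv;
    rg_Vplus_neq0 : Vplus <> 0%VS;
    rg_irreducible : irreducible_over iota Vzero Vplus;
    rg_sl2 : exists Im Ip, [/\ Im \in Vminus, Ip \in Vplus & sl2_triple Im H0 Ip]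
  }.

End Grading.

Section Roots.
Context (F : fieldType) (L : lieType F) (A : {vspace L}).

Local Notation dual := 'Hom(subvs_of A, F^o).

Implicit Types (mu : dual) (Pi : seq dual).

Definition root_space mu : {vspace L} :=
  (\bigcap_(i < \dim A)
     passmx.leigenspace (ad (vbasis A)`_i) (mu (vsproj A (vbasis A)`_i) : F))%VS.

Lemma root_spaceP mu x :
  reflect (forall h : subvs_of A, lie (vsval h) x = (mu h : F) *: x)
          (x \in root_space mu).
Proof.
have memE h : (x \in passmx.leigenspace (ad h) (mu (vsproj A h) : F))
    = (lie h x == (mu (vsproj A h) : F) *: x).
  by rewrite memv_ker add_lfunE opp_lfunE scale_lfunE id_lfunE adE subr_eq0.
rewrite memvE; apply: (iffP subv_bigcapP) => [xP h | xP i _]; last first.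
  rewrite -memvE memE; apply/eqP; rewrite -xP vsprojK //.
  by apply/vbasis_mem/mem_nth; rewrite size_tuple.
have hA := subvsP h; rewrite -{2}[h]vsvalK.
pose lxM := GRing.isLinear.Build F L L *:%R (lie^~ x)
  (fun a y z => lie_linearl a y z x).
pose lx : {linear L -> L} := HB.pack (lie^~ x) lxM.
rewrite (coord_vbasis hA) !linear_sum [LHS](linear_sum lx) scaler_suml.
apply: eq_bigr => i _; rewrite !linearZ -scalerA.
by have := xP i isT; rewrite -memvE memE => /eqP <-.
Qed.

Definition is_root mu : Prop := mu <> 0 /\ root_space mu <> 0%VS.

Definition is_root_basis Pi : Prop :=
  [/\ free Pi,
      forall nu, nu \in Pi -> is_root nu &
      forall mu, is_root mu -> exists c : nat -> nat,
        mu = \sum_(i < size Pi) Pi`_i *+ c i \/ mu = - \sum_(i < size Pi) Pi`_i *+ c i].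

Definition is_pos_root Pi mu : Prop :=
  is_root mu /\ exists c : nat -> nat, mu = \sum_(i < size Pi) Pi`_i *+ c i.

(* 0 is excluded too, so that a root is never strongly orthogonal to itself. *)
Definition strongly_orthogonal mu nu : Prop :=
  [/\ mu + nu <> 0, ~ is_root (mu + nu), mu - nu <> 0 & ~ is_root (mu - nu)].

Definition descent_pos_root Pi (lam : nat -> dual) (j : nat) mu : Prop :=
  is_pos_root Pi mu /\ forall i : nat, (i < j)%N -> strongly_orthogonal mu (lam i).

Definition descent_simple_root Pi (lam : nat -> dual) (j : nat) mu : Prop :=
  descent_pos_root Pi lam j mu /\
  ~ exists mu1 mu2, [/\ descent_pos_root Pi lam j mu1,
                        descent_pos_root Pi lam j mu2 & mu = mu1 + mu2].

Definition root_sl2 mu : L -> Prop :=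
  generated (fun x => x \in root_space mu \/ x \in root_space (- mu)).

Definition sum_root_sl2 (lam : nat -> dual) (j : nat) (y : L) : Prop :=
  exists f : 'I_j -> L, (forall i : 'I_j, root_sl2 (lam i) (f i)) /\ y = \sum_i f i.

Definition descent_centralizer (lam : nat -> dual) (j : nat) : L -> Prop :=
  centralizes (sum_root_sl2 lam j).

(* lam 0, ..., lam k are the roots produced by the descent (the values of lam
   beyond k are irrelevant).  That the process does not stop before k is implied
   by the existence of lam j for j <= k: its root space lies both in
   Vplus H0 and in the j-th centralizer. *)
Definition is_descent (H0 : L) Pi (lam : nat -> dual) (k : nat) : Prop :=
  (forall j : nat, (j <= k)%N ->
     descent_simple_root Pi lam j (lam j) /\ lam j (vsproj A H0) = 2%:R) /\
  (forall x, x \in Vplus H0 -> descent_centralizer lam k.+1 x -> x = 0).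

End Roots.

Section ElementaryAutomorphisms.
Context (F : fieldType) (L : lieType F).

(* e^(ad x), for ad x nilpotent on L: the terms from \dim {:L} on are zero. *)
Definition exp_ad (x v : L) : L :=
  \sum_(i < \dim {:L}) (i`!%:R : F)^-1 *: iter i (lie x) v.

Definition ad_nilpotent_on (U : {vspace L}) (x : L) : Prop :=
  exists n : nat, forall y, y \in U -> iter n (lie x) y = 0.

(* Aut_e(U), for a reductive subalgebra U, acting on L: every generator e^(ad x)
   of Aut_e(U) comes from some x in [U, U], and lets e^(ad x) act on the whole of
   L; since [U, U] is semisimple, ad x is then nilpotent on L as well as on U.
   Inverses are the e^(ad (- x)). *)
Inductive Aut_e (U : {vspace L}) : (L -> L) -> Prop :=
| Aut_e_id : Aut_e U id
| Aut_e_comp (x : L) (phi : L -> L) :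
    x \in derived U -> ad_nilpotent_on U x -> Aut_e U phi ->
    Aut_e U (exp_ad x \o phi).

End ElementaryAutomorphisms.

(* Main.v *)
(* Order the descent as lam 0, ..., lam k and let the j-th layer of V+ be the
   part killed by the coroots of lam 0, ..., lam (j-1).  Suppose X is already
   conjugate to x + w with x in the sum of the first j root spaces and w <> 0 in
   the j-th layer.  The j-th layer is irreducible under the corresponding part
   of g, so products of exponentials of weight vectors of g move w until its
   component v2 of weight 2 for the coroot h of lam j is nonzero.  As lam j is
   simple in the j-th descended root system, that weight space is exactly the
   root space of lam j.  A nonzero v2 in it lies in an sl2-triple (Y, h, v2),
   and ad Y produces the nilpotent element whose exponential removes the
   component of weight 1; what is left besides v2 lies in the next layer.  The
   last layer centralizes all the root sl2's, hence is zero.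

   Everything uses only the grading, characteristic 0 and irreducibility: for
   the trace form of the adjoint representation, an x in V+ orthogonal to the
   kernel of (ad x)^2 on V- lies in the image of (ad x)^2, which gives the
   sl2-triples. *)
Require Import Defs.
From HB Require Import structures.
From mathcomp Require Import all_boot all_order all_algebra all_field.
From mathcomp Require Import ring.
From Stdlib Require Import Classical.
Set Implicit Arguments.
Unset Strict Implicit.
Unset Printing Implicit Defensive.
Import Order.TTheory GRing.Theory Num.Theory.
Local Open Scope ring_scope.

(** The driving fact is that the grading has three degrees. For a triple (Y, h, X) with X in V+ and
    Y in V-, it confines the weights of h to 0, 1, 2 on V+, to -1, 0, 1 on g and to -2, -1, 0 on V-;
    most brackets and roots excluded below would have a weight or a degree outside these ranges. The
    obstacle is that irreducibility speaks of all of g, while only nilpotent elements can be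
    exponentiated. The elements used are those of nonzero weight for some a in A: they are nilpotent
    and lie in [g, g]. Brackets with the centralizer of A, which is not of this kind, are handled by
    pushing them past the others. Earlier steps are not undone: for l < j, such an element of the
    j-th part of g maps the root space of lam l into itself, because this is a full weight space for
    the coroots, and also shifts its weight for a; hence it kills it. *)

Section LieBasics.
Context (F : fieldType) (L : lieType F).
Implicit Types (x y z : L) (P Q : L -> Prop).

Lemma lie0r x : lie x 0 = 0. Proof. exact: linear0. Qed.
Lemma lieDr x y z : lie x (y + z) = lie x y + lie x z. Proof. exact: linearD. Qed.
Lemma lieNr x y : lie x (- y) = - lie x y. Proof. exact: linearN. Qed.
Lemma lieZr a x y : lie x (a *: y) = a *: lie x y. Proof. exact: linearZ. Qed.
Lemma lie_anti x y : lie x y = - lie y x.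
Proof.
have lieDl u v w : lie (u + v) w = lie u w + lie v w.
  by rewrite -[u]scale1r lie_linearl !scale1r.
have := liexx (x + y); rewrite lieDl !lieDr !liexx add0r addr0 => /eqP.
by rewrite addr_eq0 => /eqP.
Qed.
Lemma lieDl x y z : lie (x + y) z = lie x z + lie y z.
Proof. by rewrite -[x]scale1r lie_linearl !scale1r. Qed.
Lemma lie0l x : lie 0 x = 0. Proof. by rewrite lie_anti lie0r oppr0. Qed.
Lemma lieNl x y : lie (- x) y = - lie x y.
Proof. by rewrite lie_anti lieNr -lie_anti lie_anti. Qed.
Lemma lieZl a x y : lie (a *: x) y = a *: lie x y.
Proof. by rewrite -[a *: x]addr0 lie_linearl lie0l addr0. Qed.

Definition lieE := (lieDl, lieDr, lieNl, lieNr, lieZl, lieZr, lie0l, lie0r).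

Lemma lie_derivation x y z : lie x (lie y z) = lie (lie x y) z + lie y (lie x z).
Proof.
have /eqP := lie_jacobi x y z; rewrite -addrA addr_eq0 => /eqP->.
by rewrite opprD addrC (lie_anti z (lie x y)) opprK (lie_anti z x) lieNr opprK.
Qed.

Lemma coord_inj x y :
  (forall i, coord (vbasis fullv) i x = coord (vbasis fullv) i y) -> x = y.
Proof.
move=> eqxy; rewrite (coord_vbasis (memvf x)) (coord_vbasis (memvf y)).
by apply: eq_bigr => i _; rewrite eqxy.
Qed.

End LieBasics.

(** Vector identities are checked on coordinates in [vbasis fullv], where [ring] and [field] apply.
    Brackets of atoms become opaque scalars, so they have to be rewritten to a common form
    beforehand. *)
Ltac lin_push := rewrite ?lieE; rewrite ?(linearD, linearN, linearZ, linear0) /=.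
Ltac lin_ring := let i := fresh "i" in apply: coord_inj => i; lin_push; ring.
Ltac lin_field := let i := fresh "i" in apply: coord_inj => i; lin_push; field.

(** * Linear algebra *)

Section LinearPredicates.
Context (F : fieldType) (V : vectType F).
Implicit Types (u v : V) (P E : V -> Prop).

(** Subspaces are kept as [Prop] predicates because their conditions are existential or quantify
    over all coroots; [linear_pred_vspace] converts them when a basis is needed. *)
Definition linear_pred P : Prop :=
  P 0 /\ forall (a : F) u v, P u -> P v -> P (a *: u + v).

Section Closure.
Context (P : V -> Prop) (linP : linear_pred P).

Lemma linear_predD u v : P u -> P v -> P (u + v).
Proof. by move=> Pu Pv; rewrite -[u]scale1r; apply: linP.2. Qed.

Lemma linear_predZ a u : P u -> P (a *: u).
Proof. by move=> Pu; rewrite -[_ *: _]addr0; apply: linP.2 => //; apply: linP.1. Qed.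

Lemma linear_predN u : P u -> P (- u).
Proof. by rewrite -scaleN1r; apply: linear_predZ. Qed.

Lemma linear_predB u v : P u -> P v -> P (u - v).
Proof. by move=> Pu /linear_predN; apply: linear_predD. Qed.

Lemma linear_pred_sum I (r : seq I) (f : I -> V) :
  (forall i, P (f i)) -> P (\sum_(i <- r) f i).
Proof.
by move=> Pf; elim/big_ind: _ => //; [exact: linP.1 | exact: linear_predD].
Qed.

Lemma linear_pred_span (U : {vspace V}) :
  (forall i, P (vbasis U)`_i) -> forall u, u \in U -> P u.
Proof.
move=> PU u uU; rewrite (coord_vbasis uU).
by apply: linear_pred_sum => i; apply: linear_predZ.
Qed.

Lemma linear_pred_vspace : exists U : {vspace V}, forall v, v \in U <-> P v.
Proof.
suff: forall n (U : {vspace V}), (forall v, v \in U -> P v) ->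
  (\dim {:V} - \dim U <= n)%N -> exists U : {vspace V}, forall v, v \in U <-> P v.
  move/(_ (\dim {:V}) 0%VS); apply; last by rewrite leq_subr.
  by move=> v; rewrite memv0 => /eqP->; exact: linP.1.
elim=> [|n IHn] U UP.
  rewrite leqn0 subn_eq0 => dimU; exists U => v; split; first exact: UP.
  have /eqP-> : U == fullv by rewrite eqEdim subvf.
  by rewrite memvf.
case: (classic (exists2 v, P v & v \notin U)) => [[v Pv vU] | noP].
  move=> dimU; apply: (IHn (U + <[v]>)%VS).
    move=> w /memv_addP[u uU [x /vlineP[c ->] ->]].
    by apply: linear_predD; [exact: UP | exact: linear_predZ].
  have : (\dim U < \dim (U + <[v]>)%VS)%N.
    rewrite (ltn_leqif (dimv_leqif_sup (addvSl _ _))).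
    by apply: contra vU => /subvP; apply; rewrite memvE addvSr.
  have : (\dim (U + <[v]>)%VS <= \dim {:V})%N by rewrite dimvS ?subvf.
  move=> le1 lt1; rewrite leq_subLR in dimU; rewrite leq_subLR.
  by rewrite (leq_trans dimU) // addnS -addSn leq_add2r.
move=> _; exists U => v; split; first exact: UP.
by move=> Pv; apply/negPn/negP => vU; apply: noP; exists v.
Qed.

End Closure.

(** Decompositions into eigenvectors carry neither an index set nor directness, so that they can be
    refined summand by summand with [sum_of_trans]. *)
Inductive sum_of E : V -> Prop :=
| sum_of0 : sum_of E 0
| sum_ofD u v : E u -> sum_of E v -> sum_of E (u + v).

Lemma sum_of_add E u v : sum_of E u -> sum_of E v -> sum_of E (u + v).
Proof.
elim=> [|w x Ew _ IH] sv; first by rewrite add0r.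
by rewrite -addrA; apply: sum_ofD => //; apply: IH.
Qed.

Lemma sum_of1 E u : E u -> sum_of E u.
Proof. by move=> Eu; rewrite -[u]addr0; apply: sum_ofD => //; apply: sum_of0. Qed.

Lemma sum_of_trans E E' u :
  (forall v, E v -> sum_of E' v) -> sum_of E u -> sum_of E' u.
Proof.
move=> EE'; elim=> [|v w Ev _ IH]; first exact: sum_of0.
by apply: sum_of_add => //; apply: EE'.
Qed.

Lemma sum_of_linear_pred E P u :
  linear_pred P -> (forall v, E v -> P v) -> sum_of E u -> P u.
Proof.
move=> linP EP; elim=> [|v w Ev _ IH]; first exact: linP.1.
by apply: linear_predD => //; apply: EP.
Qed.

(** A free family in E that does not span can be extended by a vector of E, since otherwise its span
    would contain every sum of vectors of E. *)
Lemma sum_of_basis E : (forall v, sum_of E v) ->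
  exists e : seq V, basis_of fullv e /\ forall v, v \in e -> E v.
Proof.
move=> EV.
suff: forall n (e : seq V), free e -> (forall v, v \in e -> E v) ->
  (\dim {:V} - size e <= n)%N ->
  exists e : seq V, basis_of fullv e /\ forall v, v \in e -> E v.
  by move/(_ (\dim {:V}) [::]); apply; rewrite ?nil_free ?leq_subr.
elim=> [|n IHn] e free_e eE dime.
  exists e; split=> //; rewrite basisEfree free_e subvf /=.
  by rewrite -subn_eq0 -leqn0.
case: (classic (exists2 v, E v & v \notin <<e>>%VS)) => [[v Ev ve]|noE].
  apply: (IHn (v :: e)).
  - by rewrite free_cons ve.
  - by move=> w; rewrite inE => /orP[/eqP->|/eE].
  - by rewrite /= subnS -subn1 leq_subLR add1n.
exists e; split=> //; rewrite basisEdim; apply/andP; split; last first.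
  by have /eqP <- := free_e; rewrite dimvS ?subvf.
apply/subvP => v _.
apply: (@sum_of_linear_pred E (fun v => v \in <<e>>%VS)) (EV v).
  by split=> [|a u w ue we]; [exact: mem0v | rewrite memvD ?memvZ].
by move=> w Ew; apply/negPn/negP => we; apply: noE; exists w.
Qed.

End LinearPredicates.

(** * Products of factors f - c and eigenvector decompositions *)

Section Eigenvectors.
Context (F : fieldType) (V : vectType F) (f : {linear V -> V}).
Implicit Types (u v : V) (s : seq F).

(** The product of the operators f - c, c in s, applied to v. The roots form a list so that they can
    be permuted and enlarged. *)
Definition shifts s v := foldr (fun c u => f u - c *: u) v s.

Lemma shifts_is_linear s : linear (shifts s).
Proof.
elim: s => [|c s IHs] a u v //=; rewrite IHs linearP scalerDr scalerA mulrC.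
by rewrite -scalerA scalerBr opprD addrACA.
Qed.
HB.instance Definition _ s :=
  GRing.isLinear.Build F V V *:%R (shifts s) (shifts_is_linear s).

Lemma shifts_eigenvector s c u :
  f u = c *: u -> shifts s u = (\prod_(d <- s) (c - d)) *: u.
Proof.
move=> fu; elim: s => [|d s IHs] /=; first by rewrite big_nil scale1r.
rewrite IHs linearZ /= fu !scalerA -scalerBl big_cons; congr (_ *: _).
by rewrite mulrBl mulrC.
Qed.

Lemma shiftsC s c v : shifts s (f v - c *: v) = f (shifts s v) - c *: shifts s v.
Proof.
have fB a u w : f (u - a *: w) = f u - a *: f w by rewrite linearB linearZ.
elim: s => //= d s ->; rewrite !fB !scalerBr !scalerA (mulrC d) !opprB.
by rewrite addrACA [RHS]addrACA [- _ - _]addrC.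
Qed.

Lemma shifts_rem s c v : c \in s -> shifts s v = shifts (rem c s) (f v - c *: v).
Proof.
elim: s => //= d s IHs; rewrite inE eq_sym; case: eqP => [-> _ | _ /= /IHs -> //].
by rewrite shiftsC.
Qed.

(** [uniq s] makes inclusion of the entries an inclusion with multiplicities: a repeated factor of s
    could occur only once in t. *)
Lemma shifts_subset s t v : uniq s -> {subset s <= t} -> shifts s v = 0 -> shifts t v = 0.
Proof.
elim: s t v => [|c s IHs] t v /=; first by move=> _ _ ->; rewrite linear0.
case/andP=> cs uniq_s sub; rewrite -shiftsC (shifts_rem _ (sub c _)) ?inE ?eqxx //.
apply: IHs => // d ds; apply: rem_mem; last by apply: sub; rewrite inE ds orbT.
by apply: contraNneq cs => <-.
Qed.

Lemma shifts_stable (P : V -> Prop) s v : linear_pred P ->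
  (forall u, P u -> P (f u)) -> P v -> P (shifts s v).
Proof.
move=> linP fP Pv; elim: s => //= c s IHs.
by apply: linear_predB => //; [exact: fP | exact: linear_predZ].
Qed.

(** The vector u = [shifts s v] is an eigenvector for c, and the remaining factors multiply it by
    the nonzero scalar r; hence v - u / r is killed by the factors in s alone. P keeps the
    components in a given stable subspace. *)
Lemma eigenvector_decomposition (P : V -> Prop) s v : linear_pred P ->
  (forall u, P u -> P (f u)) -> uniq s -> P v -> shifts s v = 0 ->
  sum_of (fun u => P u /\ exists2 c, c \in s & f u = c *: u) v.
Proof.
move=> linP fP; elim: s v => [|c s IHs] v /=; first by move=> _ _ ->; exact: sum_of0.
case/andP=> cs uniq_s Pv /eqP; rewrite subr_eq0 => /eqP fu.
set u := shifts s v in fu; set r := \prod_(d <- s) (c - d).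
have r0 : r != 0.
  rewrite prodf_seq_neq0; apply/allP => d ds /=; rewrite subr_eq0.
  by apply: contraNneq cs => ->.
have Pu : P u by exact: shifts_stable.
rewrite -[v](subrK (r^-1 *: u)) addrC; apply: sum_ofD.
  split; first exact: linear_predZ.
  by exists c; rewrite ?inE ?eqxx // linearZ /= fu !scalerA mulrC.
apply: (@sum_of_trans _ _ (fun u => P u /\ exists2 c, c \in s & f u = c *: u)).
  by move=> w [Pw [d ds fw]]; apply: sum_of1; split=> //; exists d; rewrite ?inE ?ds ?orbT.
apply: IHs => //; first by apply: linear_predB => //; exact: linear_predZ.
by rewrite linearB linearZ /= (shifts_eigenvector _ fu) scalerA mulVf // scale1r subrr.
Qed.

(** The bound on [size s] is what later limits the number of nonzero iterates in
    [ad_eigenvector_nilpotent]. *)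
Lemma eigenbasis_shifts (e : seq V) : basis_of fullv e ->
  (forall v, v \in e -> exists c, f v = c *: v) ->
  exists2 s, uniq s && (size s <= \dim {:V})%N & forall v, shifts s v = 0.
Proof.
move=> e_basis eE.
have [s size_s es] : exists2 s, size s = size e &
    forall v, v \in e -> exists2 c, c \in s & f v = c *: v.
  elim: e eE {e_basis} => [|u e IHe] eE; first by exists [::].
  have [|s size_s es] := IHe; first by move=> v ve; apply: eE; rewrite inE ve orbT.
  have [|c fu] := eE u; first by rewrite inE eqxx.
  exists (c :: s) => [|v]; rewrite /= ?size_s //  inE => /orP[/eqP-> | /es[d ds fv]].
    by exists c; rewrite ?inE ?eqxx.
  by exists d; rewrite // inE ds orbT.
exists (undup s) => [|v].
  rewrite undup_uniq (leq_trans (size_undup s)) // size_s.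
  by rewrite (size_basis (X := in_tuple e) e_basis).
have: v \in <<e>>%VS by rewrite (span_basis e_basis) memvf.
move/(@coord_span _ _ _ (in_tuple e)) ->; rewrite linear_sum big1 // => i _.
have [|c cs fe] := es (in_tuple e)`_i; first by rewrite mem_nth.
rewrite linearZ /= (shifts_eigenvector _ fe) (big_rem c) ?mem_undup //=.
by rewrite subrr mul0r scale0r scaler0.
Qed.

End Eigenvectors.

Lemma char0_intr_eq0 (F : fieldType) (n : int) : [pchar F] =i pred0 ->
  (n%:~R == 0 :> F) = (n == 0).
Proof.
move=> /pcharf0P F0; case: n => n; first by rewrite -pmulrn F0.
by rewrite NegzE mulrNz -pmulrn oppr_eq0 F0.
Qed.

Lemma char0_intr_inj (F : fieldType) : [pchar F] =i pred0 -> injective (intr : int -> F).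
Proof.
by move=> F0 m n /eqP; rewrite -subr_eq0 -intrB char0_intr_eq0 // subr_eq0 => /eqP.
Qed.

(** * Traces of nilpotent and of diagonalizable operators *)

Section Trace.
Context (F : fieldType) (V : vectType F).
Implicit Types (f g : 'End(V)).
Import passmx.

Definition lfun_trace f : F := \tr (mxof (vbasis {:V}) (vbasis {:V}) f).
Local Notation tr := lfun_trace.
Let eB := vbasisP {:V}.

Lemma lfun_traceD f g : tr (f + g) = tr f + tr g.
Proof. by rewrite /tr linearD linearD. Qed.

Lemma lfun_traceN f : tr (- f) = - tr f.
Proof. by rewrite /tr linearN linearN. Qed.

Lemma lfun_traceZ a f : tr (a *: f) = a * tr f.
Proof. by rewrite /tr linearZ linearZ. Qed.

Lemma lfun_trace_comp f g : tr (f \o g)%VF = tr (g \o f)%VF.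
Proof. by rewrite /tr !(mxof_comp _ _ eB) mxtrace_mulC. Qed.

Lemma lfun_trace_basis (e : (\dim {:V}).-tuple V) f :
  basis_of fullv e -> tr f = \tr (mxof e e f).
Proof.
move=> e_basis; rewrite /tr -[f in LHS]comp_lfun1l (mxof_comp _ _ e_basis).
rewrite mxtrace_mulC -(mxof_comp _ _ eB) //.
by rewrite comp_lfun1r.
Qed.

(** Rank factorization M = C R: the trace of M is that of R C, whose nilpotency exponent is one less
    because C cancels on the left and R on the right. The size of the matrix changes, hence the
    induction over all n. *)
Lemma mxtrace_nilpotent m n (M : 'M[F]_n) :
  iter m (mulmx M) 1%:M = 0 -> \tr M = 0.
Proof.
elim: m n M => [|m IHm] n M /=.
  by move=> M1; rewrite -[M]mulmx1 M1 mulmx0 linear0.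
have /row_freeP := row_base_free M; have /row_fullP := col_base_full M.
move: (col_base M) (row_base M) (mulmx_base M) => C R defM [C' C'C] [R' RR'].
have iterE k : iter k.+1 (mulmx M) 1%:M = C *m iter k (mulmx (R *m C)) 1%:M *m R.
  elim: k => [|k IHk]; first by rewrite /= !mulmx1 defM.
  by rewrite iterS IHk -{1}defM /= !mulmxA.
rewrite -[_ *m _]/(iter m.+1 (mulmx M) 1%:M) iterE => M0.
rewrite -defM mxtrace_mulC; apply: IHm.
move: M0 => /(congr1 (fun A => C' *m A *m R')).
by rewrite !mulmxA C'C mul1mx -mulmxA RR' mulmx1 mulmx0 mul0mx.
Qed.

Lemma lfun_trace_nilpotent m f : (forall v, iter m f v = 0) -> tr f = 0.
Proof.
move=> fm; apply: (@mxtrace_nilpotent m).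
have iterE k : iter k (mulmx (mxof (vbasis {:V}) (vbasis {:V}) f)) 1%:M =
    mxof (vbasis {:V}) (vbasis {:V}) (iter k (fun g => (g \o f)%VF) \1%VF).
  elim: k => [|k IHk] /=; first by rewrite mxof1 // (basis_free eB).
  by rewrite IHk (mxof_comp _ _ eB).
rewrite iterE; set g := iter _ _ _.
suff -> : g = 0 by rewrite linear0.
apply/lfunP => v; rewrite zero_lfunE -(fm v) /g.
by elim: (m) v => [|k IHk] v; rewrite ?id_lfunE // iterS comp_lfunE IHk -iterSr.
Qed.

(* In an eigenbasis the trace of f \o f is a sum of squares of integers. *)
Lemma lfun_trace_sqr_eq0 f : [pchar F] =i pred0 ->
  (forall v, sum_of (fun u => exists n : int, f u = n%:~R *: u) v) ->
  tr (f \o f)%VF = 0 -> f = 0.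
Proof.
move=> F0 /sum_of_basis[e [e_basis eE]].
have size_e : size e == \dim {:V} 
  by apply/eqP; exact: (esym (size_basis (U := fullv) (X := in_tuple e) e_basis)).
pose t := Tuple size_e; have t_basis : basis_of fullv t by [].
have /fin_all_exists[n fE] : forall i : 'I_(\dim {:V}), exists n : int, f t`_i = n%:~R *: t`_i.
  by move=> i; apply/eE/mem_nth; rewrite (eqP size_e).
rewrite (lfun_trace_basis _ t_basis).
have -> : \tr (mxof t t (f \o f)%VF) = \sum_i ((n i ^+ 2)%:~R : F).
  apply: eq_bigr => i _; rewrite !mxE /= vecof_delta comp_lfunE fE linearZ /= fE scalerA.
  by rewrite !linearZ /= coord_free ?(basis_free t_basis) // eqxx mulr1 -intrM expr2.
rewrite -rmorph_sum /= => /eqP.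
rewrite char0_intr_eq0 //.
rewrite psumr_eq0 => [/allP n0|i _]; last exact: sqr_ge0.
apply/lfunP => v; rewrite zero_lfunE (coord_basis t_basis (memvf v)) linear_sum big1 // => i _.
have := n0 i (mem_index_enum i); rewrite /= sqrf_eq0 => /eqP ni.
by rewrite linearZ /= fE ni scale0r scaler0.
Qed.

End Trace.

(** * sl2-triples in a graded Lie algebra *)

Section AdEigenvectors.
Context (F : fieldType) (L : lieType F).
Implicit Types (x y z h : L).

Definition eig h (c : F) x : Prop := lie h x = c *: x.

Lemma eig_linear h c : linear_pred (eig h c).
Proof.
split=> [|a x y hx hy]; first by rewrite /eig lie0r scaler0.
by rewrite /eig !lieE hx hy scalerDr !scalerA mulrC.
Qed.

Lemma eig_lie h a b x y : eig h a x -> eig h b y -> eig h (a + b) (lie x y).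
Proof.
by rewrite /eig => hx hy; rewrite lie_derivation hx hy !lieE -scalerDl.
Qed.

Lemma eig_inj h a b x : eig h a x -> eig h b x -> a != b -> x = 0.
Proof.
rewrite /eig => -> /eqP; rewrite -subr_eq0 -scalerBl scaler_eq0 subr_eq0.
by move=> /orP[/eqP->|/eqP//]; rewrite eqxx.
Qed.

Lemma eig_commute h z c x : lie h z = 0 -> eig h c x -> eig h c (lie z x).
Proof.
move=> hz hx; rewrite -[c]add0r; apply: eig_lie hx.
by rewrite /eig scale0r.
Qed.

Lemma mem_leigenspace h c x : x \in passmx.leigenspace (ad h) c <-> eig h c x.
Proof.
rewrite memv_ker add_lfunE opp_lfunE scale_lfunE id_lfunE adE subr_eq0.
by split=> [/eqP | ->].
Qed.

(** The Killing form of L. It is degenerate when L has a centre, so nondegeneracy is only sought for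
    the pairing of V+ with V-. *)
Definition trace_form x y : F := lfun_trace (ad x \o ad y)%VF.

Lemma ad_lie x y : ad (lie x y) = (ad x \o ad y)%VF - (ad y \o ad x)%VF.
Proof.
by apply/lfunP => z; rewrite add_lfunE opp_lfunE !comp_lfunE !adE (lie_derivation x) addrK.
Qed.

Lemma ad_linear a x y : ad (a *: x + y) = a *: ad x + ad y.
Proof. by apply/lfunP => z; rewrite add_lfunE scale_lfunE !adE !lieE. Qed.

Lemma trace_formC x y : trace_form x y = trace_form y x.
Proof. exact: lfun_trace_comp. Qed.

Lemma trace_form_linear y a x z :
  trace_form (a *: x + z) y = a * trace_form x y + trace_form z y.
Proof.
by rewrite /trace_form ad_linear comp_lfunDl -comp_lfunZl lfun_traceD lfun_traceZ.
Qed.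

Lemma trace_form_linear_pred y : linear_pred (fun x => trace_form x y = 0).
Proof.
split=> [|a x z xy zy]; last by rewrite trace_form_linear xy zy mulr0 addr0.
by have := trace_form_linear y 1 0 0; rewrite scaler0 addr0 mul1r => /eqP;
  rewrite addrC -subr_eq subrr => /eqP.
Qed.

Lemma trace_form_invariant a x y : trace_form (lie a x) y = - trace_form x (lie a y).
Proof.
rewrite /trace_form !ad_lie !(comp_lfunDl, comp_lfunDr, comp_lfunNl, comp_lfunNr).
rewrite !(lfun_traceD, lfun_traceN) !comp_lfunA opprB.
by rewrite -(comp_lfunA (ad a)) (lfun_trace_comp (ad a)).
Qed.

End AdEigenvectors.

Section Sl2.
Context (F : fieldType) (F0 : [pchar F] =i pred0) (L : lieType F) (H0 : L).
Context (grading : forall x : L, lie H0 (lie H0 (lie H0 x)) = 4%:R *: lie H0 x).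
Implicit Types (x y z u v w : L).

Lemma char0_natf_neq0 n : (n.+1%:R : F) != 0.
Proof. by rewrite ((pcharf0P F).1 F0). Qed.

Lemma scaler_nat_eq0 n v : n.+1%:R *: v = 0 -> v = 0.
Proof. by move=> /eqP; rewrite scaler_eq0 (negPf (char0_natf_neq0 n)) => /eqP. Qed.

Lemma eig_outside c x : eig H0 c x -> c * (c ^+ 2 - 4%:R) != 0 -> x = 0.
Proof.
move=> Hx c0; have := grading x; rewrite Hx !lieE Hx !lieE Hx !scalerA => /eqP.
rewrite -subr_eq0 -scalerBl scaler_eq0 => /orP[/eqP c1|/eqP //].
by case/eqP: c0; rewrite -c1; ring.
Qed.

Lemma eig4 x : eig H0 4%:R x -> x = 0.
Proof.
move/eig_outside; apply; rewrite (_ : _ * _ = 48%:R) ?char0_natf_neq0 //; ring.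
Qed.

Lemma eigN4 x : eig H0 (- 4%:R) x -> x = 0.
Proof.
move/eig_outside; apply; rewrite (_ : _ * _ = - 48%:R) ?oppr_eq0 ?char0_natf_neq0 //; ring.
Qed.

Lemma plus_abelian x y : eig H0 2%:R x -> eig H0 2%:R y -> lie x y = 0.
Proof. by move=> Hx Hy; apply: eig4; rewrite (natrD _ 2 2); apply: eig_lie. Qed.

Lemma minus_abelian x y : eig H0 (- 2%:R) x -> eig H0 (- 2%:R) y -> lie x y = 0.
Proof.
by move=> Hx Hy; apply: eigN4; rewrite (natrD _ 2 2) opprD; apply: eig_lie.
Qed.

Context (X Y h : L) (HX : eig H0 2%:R X) (HY : eig H0 (- 2%:R) Y).
Context (triple : sl2_triple Y h X).

Lemma sl2_hX v : lie h (lie X v) = lie X (lie h v) + 2%:R *: lie X v.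
Proof. by have [hX _ _] := triple; rewrite lie_derivation hX lieZl addrC. Qed.

Lemma sl2_hY v : lie h (lie Y v) = lie Y (lie h v) - 2%:R *: lie Y v.
Proof. by have [_ hY _] := triple; rewrite lie_derivation hY lieZl addrC scaleNr. Qed.

Lemma sl2_XY v : lie X (lie Y v) = lie Y (lie X v) - lie h v.
Proof. by have [_ _ <-] := triple; rewrite lie_derivation (lie_anti X Y) lieNl addrC. Qed.

Lemma sl2_h0 : eig H0 0 h.
Proof. by have [_ _ <-] := triple; rewrite -(addNr 2%:R); apply: eig_lie. Qed.

Lemma sl2_H0h : lie H0 h = 0.
Proof. by rewrite sl2_h0 scale0r. Qed.


Lemma sl2_killed v c : lie X v = 0 -> lie Y v = 0 -> eig h c v -> c != 0 -> v = 0.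
Proof.
move=> Xv Yv hv c0; have := sl2_XY v; rewrite Xv Yv !lie0r sub0r hv => /esym/eqP.
by rewrite oppr_eq0 scaler_eq0 (negPf c0) => /eqP.
Qed.

(** (ad Y)^3 v would have degree -4, so it is zero; applying ad X to it leaves three times the
    claim. *)
Lemma sl2_YYh v : eig H0 2%:R v -> lie Y (lie Y (lie h v)) = 2%:R *: lie Y (lie Y v).
Proof.
move=> Hv; have Y3 : lie Y (lie Y (lie Y v)) = 0.
  apply: eigN4; rewrite (_ : - 4%:R = - 2%:R + (- 2%:R + (- 2%:R + 2%:R))); last by ring.
  by do 3!apply: eig_lie => //.
have Xv : lie X v = 0 by apply: plus_abelian.
have := congr1 (lie X) Y3; rewrite lie0r.
rewrite !(sl2_XY, sl2_hY, lieE, Xv) => E.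
apply/eqP; rewrite -subr_eq0; apply/eqP/(@scaler_nat_eq0 2).
rewrite -[RHS]oppr0 -[in RHS]E; lin_ring.
Qed.

(** The cubic is t (t - 1) (t - 2). The factors are peeled off one by one: (h - 2) v is killed by
    (ad Y)^2, then (h - 1)(h - 2) v by ad Y. The latter is also killed by ad X, hence by h =
    [Y, X]. *)
Lemma sl2_cubic_plus v : eig H0 2%:R v ->
  lie h (lie h (lie h v)) = 3%:R *: lie h (lie h v) - 2%:R *: lie h v.
Proof.
move=> Hv; have Hh u : eig H0 2%:R u -> eig H0 2%:R (lie h u).
  exact: eig_commute sl2_H0h.
pose w := lie h v - 2%:R *: v.
have Hw : eig H0 2%:R w.
  by apply: linear_predB (Hh _ Hv) _; [| apply: linear_predZ Hv]; exact: eig_linear.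
have Yw : lie Y (lie Y w) = 0 by rewrite /w !lieE sl2_YYh // subrr.
pose w' := lie h w - w.
have Hw' : eig H0 2%:R w' by apply: (linear_predB (eig_linear _ _) (Hh _ Hw) Hw).
have Yw' : lie Y w' = 0.
  apply: (@scaler_nat_eq0 1); have := congr1 (lie X) Yw; rewrite lie0r.
  rewrite !(sl2_XY, sl2_hY, lieE, plus_abelian HX Hw) => E.
  by rewrite -[RHS]oppr0 -[in RHS]E /w'; lin_ring.
have := sl2_XY w'; rewrite Yw' (plus_abelian HX Hw') !lieE sub0r => /esym/eqP.
rewrite oppr_eq0 => /eqP E; apply/eqP; rewrite -subr_eq0 -[X in _ == X]E /w' /w.
by apply/eqP; lin_ring.
Qed.

Lemma sl2_XX_zero z : eig H0 0 z -> lie X (lie X z) = 0.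
Proof.
move=> Hz; apply: plus_abelian => //; rewrite -[2%:R]addr0; exact: eig_lie.
Qed.

Lemma sl2_YY_zero z : eig H0 0 z -> lie Y (lie Y z) = 0.
Proof.
move=> Hz; apply: minus_abelian => //; rewrite -[- 2%:R]addr0; exact: eig_lie.
Qed.

(** This is [sl2_YYh] for [X, z]; since (ad Y)^2 vanishes on g, what is left is twice the claim. *)
Lemma sl2_Yhh z : eig H0 0 z -> lie Y (lie h (lie h z)) = lie Y (lie h z).
Proof.
move=> Hz; have Hhz := eig_commute sl2_H0h Hz.
have HXz : eig H0 2%:R (lie X z) by rewrite -[2%:R]addr0; exact: eig_lie.
have := sl2_YYh HXz.
have -> : lie h (lie X z) = lie X (lie h z) + 2%:R *: lie X z by exact: sl2_hX.
rewrite !lieE => /eqP; rewrite -[X in _ == X]add0r (inj_eq (addIr _)) => /eqP.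
have YX v : lie Y (lie X v) = lie X (lie Y v) + lie h v by rewrite sl2_XY subrK.
have hY v : lie Y (lie h v) = lie h (lie Y v) + 2%:R *: lie Y v by rewrite sl2_hY subrK.
have YYhz : lie Y (lie Y (lie h z)) = 0 by apply: sl2_YY_zero.
rewrite YX lieDr YX YYhz lie0r add0r sl2_hY => E.
apply/eqP; rewrite -subr_eq0; apply/eqP/(@scaler_nat_eq0 1).
by rewrite -[RHS]E; lin_ring.
Qed.

End Sl2.

Section Sl2Shifts.
Context (F : fieldType) (F0 : [pchar F] =i pred0) (L : lieType F) (H0 : L).
Context (grading : forall x : L, lie H0 (lie H0 (lie H0 x)) = 4%:R *: lie H0 x).
Context (X Y h : L) (HX : eig H0 2%:R X) (HY : eig H0 (- 2%:R) Y).
Context (triple : sl2_triple Y h X).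
Implicit Types (x y z u v w : L).

(** As a polynomial identity t^3 = 4 t, the grading is odd in H0, so results on V+ transfer to
    V-. *)
Let gradingN x : lie (- H0) (lie (- H0) (lie (- H0) x)) = 4%:R *: lie (- H0) x.
Proof. by rewrite !lieE grading; lin_ring. Qed.

Let eigN c x : eig H0 (- c) x -> eig (- H0) c x.
Proof. by rewrite /eig lieNl => ->; rewrite scaleNr opprK. Qed.

Let eigNX : eig (- H0) (- 2%:R) X.
Proof. by apply: eigN; rewrite opprK. Qed.

(* Exchanging the two ends of the grading also exchanges X and Y. *)
Let tripleN : sl2_triple X (- h) Y.
Proof.
have [hX hY YX] := triple; split; last by rewrite lie_anti YX.
  by rewrite lieNl hY scaleNr opprK.
by rewrite lieNl hX scaleNr.
Qed.

Lemma sl2_cubic_minus v : eig H0 (- 2%:R) v ->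
  lie h (lie h (lie h v)) = - 3%:R *: lie h (lie h v) - 2%:R *: lie h v.
Proof.
move=> /eigN Hv; have := sl2_cubic_plus F0 gradingN (eigN HY) eigNX tripleN Hv.
by rewrite !lieE => E; rewrite -[LHS]opprK -[X in X = _]opprK E; lin_ring.
Qed.

Lemma sl2_Xhh z : eig H0 0 z -> lie X (lie h (lie h z)) = - lie X (lie h z).
Proof.
move=> Hz; have := @sl2_Yhh _ F0 _ _ gradingN _ _ _ (eigN HY) eigNX tripleN z.
by rewrite !lieE opprK; apply; apply: eigN; rewrite oppr0.
Qed.

(** ad h has no Jordan block for the eigenvalue 0 on g. The vector z is replaced by some t with
    [h, t] = [h, z] that is killed by X and Y. *)
Let hh0 z : eig H0 0 z -> lie h (lie h z) = 0 -> lie h z = 0.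
Proof.
move=> Hz hhz.
have Xhz : lie X (lie h z) = 0.
  by apply/eqP; rewrite -oppr_eq0 -sl2_Xhh // hhz lie0r.
have Yhz : lie Y (lie h z) = 0 by rewrite -(sl2_Yhh F0 grading HX HY triple) // hhz lie0r.
pose XY := sl2_XY triple; pose hX := sl2_hX triple; pose hY := sl2_hY triple.
have XXz : lie X (lie X z) = 0 by apply: (sl2_XX_zero F0 grading HX).
have two_neq0 : (2%:R : F) != 0 by exact: (char0_natf_neq0 F0).
(* Since [X, [h, z]] = 0, the coefficient 1/2 makes [X, t] vanish, and h kills the correction. *)
pose t := z + 2%:R^-1 *: lie Y (lie X z).
have Ht : eig H0 0 t.
  apply: (linear_predD (eig_linear _ _)) => //; apply: (linear_predZ (eig_linear _ _)).
  rewrite -(addNr 2%:R); apply: eig_lie => //; rewrite -[2%:R]addr0; exact: eig_lie.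
have Xt : lie X t = 0.
  by rewrite /t !(lieE, XY, hX, XXz, Xhz); lin_field.
have ht : lie h t = lie h z.
  by rewrite /t !(lieE, hY, hX, Xhz); lin_field.
clearbody t; have YYt : lie Y (lie Y t) = 0 by apply: (sl2_YY_zero F0 grading HY).
have Yt : lie Y t = 0.
  apply: (scaler_nat_eq0 F0 (n := 1)).
  have := congr1 (lie X) YYt; rewrite !(XY, hY, lieE, Xt, ht, Yhz) => E.
  by rewrite -[RHS]E; lin_ring.
have := XY t; rewrite Xt Yt !lieE sub0r => /esym/eqP.
by rewrite oppr_eq0 ht => /eqP.
Qed.

(** By [sl2_Xhh] and [sl2_Yhh], h^3 z - h z is killed by X and Y, hence by h; [hh0] removes the
    extra factor h. *)
Lemma sl2_cubic_zero z : eig H0 0 z -> lie h (lie h (lie h z)) = lie h z.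
Proof.
move=> Hz; have Hh u : eig H0 0 u -> eig H0 0 (lie h u).
  by apply: eig_commute; apply: (sl2_H0h HX HY triple).
have Hhz := Hh _ Hz; have Hhhz := Hh _ Hhz.
have Hd : eig H0 0 (lie h (lie h z) - z) by apply: (linear_predB (eig_linear _ _)).
suff : lie h (lie h (lie h z) - z) = 0 by rewrite !lieE => /eqP; rewrite subr_eq0 => /eqP.
apply: hh0 => //; rewrite !lieE.
have Xw : lie X (lie h (lie h (lie h z)) - lie h z) = 0.
  by rewrite lieDr lieNr !sl2_Xhh // opprK subrr.
have Yw : lie Y (lie h (lie h (lie h z)) - lie h z) = 0.
  by rewrite lieDr lieNr !(sl2_Yhh F0 grading HX HY triple) // subrr.
have := sl2_XY triple (lie h (lie h (lie h z)) - lie h z).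
rewrite Xw Yw !lie0r sub0r => /esym/eqP.
by rewrite oppr_eq0 lieDr lieNr => /eqP.
Qed.

Lemma grading_split x : exists xm x0 xp,
  [/\ eig H0 (- 2%:R) xm, eig H0 0 x0, eig H0 2%:R xp & x = xm + x0 + xp].
Proof.
have two_neq0 : (2%:R : F) != 0 by exact: (char0_natf_neq0 F0).
have [Hx HxE] : exists Hx, lie H0 x = Hx by exists (lie H0 x).
have [HHx HHxE] : exists HHx, lie H0 Hx = HHx by exists (lie H0 Hx).
have HHHx : lie H0 HHx = 4%:R *: Hx by rewrite -HHxE -HxE grading.
(* Lagrange interpolation at the eigenvalues -2, 0, 2: t (t - 2) / 8, 1 - t^2 / 4 and t (t + 2) /
   8. *)
exists (8%:R^-1 *: (HHx - 2%:R *: Hx)), (x - 4%:R^-1 *: HHx), (8%:R^-1 *: (HHx + 2%:R *: Hx)).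
have four_neq0 : (4%:R : F) != 0 by exact: (char0_natf_neq0 F0).
have eight_neq0 : (8%:R : F) != 0 by exact: (char0_natf_neq0 F0).
have lieH := (lieZr, lieDr, lieNr, HxE, HHxE, HHHx).
by rewrite /eig; split; rewrite ?lieH; lin_field; rewrite ?eight_neq0 ?four_neq0.
Qed.

End Sl2Shifts.

Section Sl2Diagonalizable.
Context (F : fieldType) (F0 : [pchar F] =i pred0) (L : lieType F) (H0 : L).
Context (grading : forall x : L, lie H0 (lie H0 (lie H0 x)) = 4%:R *: lie H0 x).
Context (X Y h : L) (HX : eig H0 2%:R X) (HY : eig H0 (- 2%:R) Y).
Context (triple : sl2_triple Y h X).
(** The list is the union of the three sets of weights, on V-, g and V+. *)
Lemma sl2_shifts x :
  shifts (lie h) [:: - 2%:R; - 1; 2%:R; 1; 0] x = 0.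
Proof.
have [xm [x0 [xp [Hm Hz Hp ->]]]] := grading_split F0 grading x.
(* The roots are 0, c, 2c: c = 1 serves V+ and c = -1 serves V-. *)
have cubic_shifts c v : lie h (lie h (lie h v)) =
    (3%:R * c) *: lie h (lie h v) - (2%:R * c ^+ 2) *: lie h v ->
    shifts (lie h) [:: 2%:R * c; c; 0] v = 0.
  by move=> E; rewrite /= !lieE E; lin_ring.
have sub c v : c != 0 -> 2%:R * c \in [:: - 2%:R; 2%:R] -> c \in [:: - 1; 1] ->
    lie h (lie h (lie h v)) = (3%:R * c) *: lie h (lie h v) - (2%:R * c ^+ 2) *: lie h v ->
    shifts (lie h) [:: - 2%:R; - 1; 2%:R; 1; 0] v = 0.
  move=> c0 c2 c1 /cubic_shifts; apply: shifts_subset.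
    rewrite /= !inE (negPf c0) mulf_eq0 (negPf c0) (negPf (char0_natf_neq0 F0 1)) orbF andbT /=.
    by rewrite orbF andbT -subr_eq0 mulr_natl mulr2n addrK c0.
  by move=> d; move: c1 c2; rewrite !inE; do 2!case/orP=> /eqP->;
    move=> /or3P[]/eqP->; rewrite ?eqxx ?orbT.

have Em := sl2_cubic_minus F0 grading HX HY triple Hm.
have Ez := sl2_cubic_zero F0 grading HX HY triple Hz.
have Ep := sl2_cubic_plus F0 grading HX HY triple Hp.
have shift0 : shifts (lie h) [:: 1; -1; 0] x0 = 0.
  by rewrite /= !lieE Ez; lin_ring.
have shiftsD u v : shifts (lie h) [:: - 2%:R; - 1; 2%:R; 1; 0] (u + v) =
    shifts (lie h) [:: - 2%:R; - 1; 2%:R; 1; 0] u + shifts (lie h) [:: - 2%:R; - 1; 2%:R; 1; 0] v.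
  exact: linearD.
rewrite !shiftsD (sub (-1) xm) ?(sub 1 xp) ?(shifts_subset _ _ shift0) ?addr0 //.
all: rewrite ?mulrN1 ?mulr1 ?sqrrN ?expr1n ?mulr1 ?inE ?eqxx ?orbT ?oppr_eq0 ?oner_neq0 //.
- by rewrite (_ : [:: 1; _; _] = [seq n%:~R | n : int <- [:: 1; -1; 0]]) // map_inj_uniq //;
    exact: char0_intr_inj.
- by move=> d; rewrite !inE => /or3P[]/eqP->; rewrite eqxx ?orbT.
Qed.

Lemma sl2_integral_decomposition (P : L -> Prop) x :
  linear_pred P -> (forall u, P u -> P (lie h u)) -> P x ->
  sum_of (fun u => P u /\ exists n : int, lie h u = n%:~R *: u) x.
Proof.
move=> linP hP Px; have uniq_s : uniq [:: - 2%:R; - 1; 2%:R; 1; 0 : F].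
  rewrite (_ : [:: - 2%:R; _; _; _; _] = [seq n%:~R | n : int <- [:: - 2%:R; - 1; 2%:R; 1; 0]]) //.
  by rewrite map_inj_uniq //; exact: char0_intr_inj.
apply: sum_of_trans (eigenvector_decomposition linP hP uniq_s Px (sl2_shifts x)).
move=> u [Pu [c cs hu]]; apply: sum_of1; split=> //.
have /mapP[n _ cE] : c \in [seq n%:~R | n : int <- [:: - 2%:R; - 1; 2%:R; 1; 0]] by [].
by exists n; rewrite -cE.
Qed.

End Sl2Diagonalizable.

(** * Triples through every element of V+, by means of the trace form *)

Section JacobsonMorozov.
Context (F : fieldType) (F0 : [pchar F] =i pred0) (L : lieType F) (H0 : L).
Context (grading : forall x : L, lie H0 (lie H0 (lie H0 x)) = 4%:R *: lie H0 x).
Implicit Types (x y z v : L).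

Lemma plus_cube x v : eig H0 2%:R x -> lie x (lie x (lie x v)) = 0.
Proof.
move=> Hx; have [vm [v0 [vp [Hm Hz Hp ->]]]] := grading_split F0 grading v.
have Hxm : eig H0 0 (lie x vm) by rewrite -(subrr 2%:R); apply: eig_lie.
have Hxz : eig H0 2%:R (lie x v0) by rewrite -[2%:R]addr0; apply: eig_lie.
have Hxxm : eig H0 2%:R (lie x (lie x vm)) by rewrite -[2%:R]addr0; apply: eig_lie.
rewrite !lieDr (plus_abelian F0 grading Hx Hxxm) (plus_abelian F0 grading Hx Hxz).
by rewrite (plus_abelian F0 grading Hx Hp) !lie0r !addr0.
Qed.

(* Write d = ad [x, z].  Commuting (ad x)^3 = 0 with ad z successively gives
   (ad x)^2 d = 0, then (ad x) d^3 = 0, then d^7 = 0. *)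
Lemma ad_bracket_nilpotent x z : eig H0 2%:R x -> lie x (lie x z) = 0 ->
  forall v, iter 7 (lie (lie x z)) v = 0.
Proof.
move=> Hx; move dE: (lie x z) => d xd v.
have xz u : lie x (lie z u) = lie z (lie x u) + lie d u.
  by rewrite lie_derivation dE addrC.
have xdC u : lie x (lie d u) = lie d (lie x u) by rewrite lie_derivation xd lie0l add0r.
have xxd u : lie x (lie x (lie d u)) = 0.
  apply: (scaler_nat_eq0 F0 (n := 2)); have := plus_cube (lie z u) Hx.
  rewrite !(xz, lieDr) plus_cube // lie0r => E.
  by rewrite -[RHS]E !xdC; lin_ring.
have xddd u : lie x (lie d (lie d (lie d u))) = 0.
  apply: (scaler_nat_eq0 F0 (n := 1)).
  have := xxd (lie z u); rewrite (lie_derivation d).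
  rewrite !(lieDr, xz) xxd lie0r add0r => E.
  have := congr1 (lie d) E; rewrite lie0r !lieDr -!xdC xxd => {}E.
  by rewrite -[RHS]E; lin_ring.
have := xddd (lie z v).
set w := lie d (lie d (lie d (lie z v))) - lie z (lie d (lie d (lie d v))).
have -> : lie d (lie d (lie d (lie z v))) = w + lie z (lie d (lie d (lie d v))).
  by rewrite subrK.
rewrite lieDr xz xddd lie0r add0r => /(congr1 (fun u => lie d (lie d (lie d u)))).
by rewrite !lieDr -!xdC !xddd !lie0r !add0r.
Qed.

(* By invariance, 2 tr(ad x ad z) = tr(ad H0 ad [x, z]). *)
Lemma trace_form_nilpotent x z : eig H0 2%:R x -> eig H0 (- 2%:R) z ->
  lie x (lie x z) = 0 -> trace_form x z = 0.
Proof.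
move=> Hx Hz xxz; have dn := ad_bracket_nilpotent Hx xxz.
have : trace_form H0 (lie x z) = 0.
  apply: (@lfun_trace_nilpotent _ _ 7) => v.
  have H0d u : lie (lie x z) (lie H0 u) = lie H0 (lie (lie x z) u).
    rewrite [RHS]lie_derivation (_ : lie H0 (lie x z) = 0) ?lie0l ?add0r //.
    by rewrite -(scale0r (lie x z)) -(subrr 2%:R); apply: eig_lie.
  rewrite /= !comp_lfunE !adE !H0d.
  by have := dn v => /= ->; rewrite !lie0r.
rewrite trace_formC trace_form_invariant (lie_anti x) Hx trace_formC => /eqP.
rewrite oppr_eq0 => /eqP /(linear_predZ (trace_form_linear_pred z) (- 2%:R^-1)).
by rewrite scalerN scaleNr opprK scalerA mulVf ?scale1r // (char0_natf_neq0 F0 1).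
Qed.

Context (Im Ip : L) (HIp : eig H0 2%:R Ip) (HIm : eig H0 (- 2%:R) Im).
Context (tripleI : sl2_triple Im H0 Ip).
Context (irr : forall P : L -> Prop, linear_pred P ->
  (forall x, P x -> eig H0 2%:R x) ->
  (forall z x, eig H0 0 z -> P x -> P (lie z x)) ->
  (exists2 x, P x & x <> 0) -> forall x, eig H0 2%:R x -> P x).
Context (plus_neq0 : exists2 x : L, eig H0 2%:R x & x <> 0).

Lemma grading_integral v : sum_of (fun u => exists n : int, lie H0 u = n%:~R *: u) v.
Proof.
have [vm [v0 [vp [Hm Hz Hp ->]]]] := grading_split F0 grading v.
apply: sum_of_add; first apply: sum_of_add; apply: sum_of1.
- by exists (- 2%:R).
- by exists 0.
- by exists 2%:R.
Qed.

(** By invariance the trace of (ad H0)^2 is a multiple of this value. As ad H0 has integral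
    eigenvalues, a zero trace would give ad H0 = 0, hence V+ = 0. *)
Lemma trace_form_sl2_neq0 : trace_form Ip Im <> 0.
Proof.
move=> B0; have BH : lfun_trace (ad H0 \o ad H0)%VF = 0.
  rewrite -/(trace_form H0 H0); have [_ _ {1}<-] := tripleI.
  rewrite trace_form_invariant lie_anti HIm scaleNr opprK trace_formC.
  by rewrite (linear_predZ (trace_form_linear_pred _)) ?oppr0 // trace_formC.
have ad0 : ad H0 = 0.
  apply: (lfun_trace_sqr_eq0 F0) BH => v.
  by apply: sum_of_trans (grading_integral v) => u [n Hu]; apply: sum_of1; exists n; rewrite adE.
have [x Hx] := plus_neq0; apply.
by apply: (scaler_nat_eq0 F0 (n := 1)); rewrite -Hx -adE ad0 zero_lfunE.
Qed.

(** The radical in V+ is stable under g and does not contain Ip, so by irreducibility it is zero. *)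
Lemma trace_form_nondegenerate_plus x : eig H0 2%:R x ->
  (forall y, eig H0 (- 2%:R) y -> trace_form x y = 0) -> x = 0.
Proof.
move=> Hx Bx; apply: NNPP => x0.
pose P u := eig H0 2%:R u /\ forall y, eig H0 (- 2%:R) y -> trace_form u y = 0.
have [_] : P Ip; last by move/(_ _ HIm); exact: trace_form_sl2_neq0.
apply: irr HIp; last by exists x.
- split=> [|a u v [Hu Bu] [Hv Bv]].
    by split=> [|y _]; [exact: (eig_linear _ _).1 | exact: (trace_form_linear_pred y).1].
  by split=> [|y Hy]; [apply: (eig_linear _ _).2 | apply: (trace_form_linear_pred y).2; auto].
- by move=> u [].
move=> z u Hz [Hu Bu]; split; first by rewrite -[2%:R]add0r; apply: eig_lie.
move=> y Hy; rewrite trace_form_invariant Bu ?oppr0 //.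
by rewrite -[- 2%:R]add0r; apply: eig_lie.
Qed.

(** Applying ad Y to (ad X)^2 y = 0 gives [X, y] = 0 up to the factor -2. Now y is killed by X and Y
    although its weight is nonzero. *)
Lemma sl2_XX_injective X Y h y : eig H0 2%:R X -> eig H0 (- 2%:R) Y -> sl2_triple Y h X ->
  eig H0 (- 2%:R) y -> eig h (- 2%:R) y -> lie X (lie X y) = 0 -> y = 0.
Proof.
move=> HX HY triple Hy hy XXy; have Yy := minus_abelian F0 grading HY Hy.
have Xy : lie X y = 0.
  apply: (scaler_nat_eq0 F0 (n := 1)).
  have YX v : lie Y (lie X v) = lie X (lie Y v) + lie h v by rewrite (sl2_XY triple) subrK.
  have := congr1 (lie Y) XXy; rewrite !(YX, sl2_hX triple, lieE, Yy, hy) => E.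
  by rewrite -[RHS]oppr0 -[in RHS]E; lin_ring.
apply: (sl2_killed triple Xy Yy hy); rewrite oppr_eq0.
exact: (char0_natf_neq0 F0 1).
Qed.

(** Orthogonality in matrix form: M pairs a basis of the image U of (ad x)^2 with a basis of V-, and
    r pairs x with the latter. If r is a combination of the rows of M, the same combination of basis
    vectors of U differs from x by an element orthogonal to V-, that is, by zero. *)
Lemma plus_regular x : eig H0 2%:R x ->
  exists2 y, eig H0 (- 2%:R) y & lie x (lie x y) = x.
Proof.
move=> Hx; pose P u := exists2 y, eig H0 (- 2%:R) y & lie x (lie x y) = u.
have linP : linear_pred P.
  split=> [|a u v [y Hy <-] [z Hz <-]].
    by exists 0; [exact: (eig_linear _ _).1 | rewrite !lie0r].
  by exists (a *: y + z); [exact: (eig_linear _ _).2 | rewrite !lieE].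
have Hxx u : eig H0 (- 2%:R) u -> eig H0 2%:R (lie x (lie x u)).
  by move=> Hu; rewrite -{1}(addr0 2%:R) -(subrr 2%:R); do 2!apply: eig_lie => //.
have [U UP] := linear_pred_vspace linP.
have [Z ZP] := linear_pred_vspace (eig_linear H0 (- 2%:R)).
pose u i := (vbasis U)`_i; pose z i := (vbasis Z)`_i.
have zZ (j : 'I_(\dim Z)) : eig H0 (- 2%:R) (z j).
  by apply/ZP/vbasis_mem/mem_nth; rewrite size_tuple.
have uP (i : 'I_(\dim U)) : P (u i) by apply/UP/vbasis_mem/mem_nth; rewrite size_tuple.
pose M := \matrix_(i < \dim U, j < \dim Z) trace_form (u i) (z j).
pose r := \row_(j < \dim Z) trace_form x (z j).
have sum_form I (s : seq I) c (v : I -> L) y :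
    trace_form (\sum_(i <- s) c i *: v i) y = \sum_(i <- s) c i * trace_form (v i) y.
  elim: s => [|i s IHs]; first by rewrite !big_nil; exact: (trace_form_linear_pred y).1.
  by rewrite !big_cons trace_form_linear IHs.
have /submxP[d rE] : (r <= M)%MS.
  rewrite submxE; apply/eqP/rowP => j; rewrite mxE [RHS]mxE.
  (* A column of the cokernel of M is a vector w of V- orthogonal to U. By invariance (ad x)^2 w is
     orthogonal to V-, hence zero, and [trace_form_nilpotent] makes x orthogonal to w. *)
  pose w := \sum_(i < \dim Z) cokermx M i j *: z i.
  have formw y : trace_form y w = \sum_(i < \dim Z) trace_form y (z i) * cokermx M i j.
    by rewrite trace_formC sum_form; apply: eq_bigr => i _; rewrite trace_formC mulrC.
  have Hw : eig H0 (- 2%:R) w.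
    apply: (linear_pred_sum (eig_linear _ _)) => i.
    exact/(linear_predZ (eig_linear _ _))/zZ.
  transitivity (trace_form x w); first by rewrite formw; apply: eq_bigr => i _; rewrite mxE.
  apply: trace_form_nilpotent => //; apply: trace_form_nondegenerate_plus (Hxx _ Hw) _ => y Hy.
  rewrite !trace_form_invariant opprK trace_formC.
  have : lie x (lie x y) \in U by apply/UP; exists y.
  move/(linear_pred_span (P := fun v => trace_form v w = 0)); apply.
    exact: trace_form_linear_pred.
  (* [linear_pred_span] ranges over all naturals; past the dimension the entry is the default 0. *)
  move=> i; case: (ltnP i (\dim U)) => iU; last first.
    rewrite nth_default ?size_tuple //; exact: (trace_form_linear_pred _).1.
  have := congr1 (fun A : 'M_(_, _) => A (Ordinal iU) j) (mulmx_coker M).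
  rewrite mxE [RHS]mxE formw => E; rewrite -[RHS]E.
  by apply: eq_bigr => l _; rewrite [M _ _]mxE.
suff xE : x = \sum_(i < \dim U) d 0 i *: u i.
  change (P x); rewrite xE.
  by apply: (linear_pred_sum linP) => i; apply: (linear_predZ linP).
apply/eqP; rewrite -subr_eq0; apply/eqP/trace_form_nondegenerate_plus.
  apply: (linear_predB (eig_linear _ _)) => //; apply: (linear_pred_sum (eig_linear _ _)) => i.
  by apply: (linear_predZ (eig_linear _ _)); have [y Hy <-] := uP i; exact: Hxx.
move=> y /ZP yZ; rewrite trace_formC.
apply: (linear_pred_span (P := fun y => trace_form y _ = 0)) yZ.
  exact: trace_form_linear_pred.
move=> j; case: (ltnP j (\dim Z)) => jZ; last first.
  rewrite nth_default ?size_tuple //; exact: (trace_form_linear_pred _).1.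
rewrite trace_formC -[x - _]addrC -scaleN1r trace_form_linear sum_form mulN1r addrC.
have := congr1 (fun A : 'rV_(_) => A 0 (Ordinal jZ)) rE.
rewrite !mxE => ->; apply/eqP; rewrite subr_eq0; apply/eqP/eq_bigr => i _.
by rewrite mxE.
Qed.

(* On the kernel of ad X in V-, ad h vanishes; this is why h and the bracket
   [h, Y] already complete X to a triple. *)
Lemma sl2_triple_of_regular X Y : eig H0 2%:R X -> eig H0 (- 2%:R) Y ->
  lie (lie Y X) X = 2%:R *: X ->
  sl2_triple (- 2%:R^-1 *: lie (lie Y X) Y) (lie Y X) X.
Proof.
move=> HX HY; move hE: (lie Y X) => h hX.
have h2 : (2%:R : F) != 0 by exact: (char0_natf_neq0 F0 1).
(* w measures how far Y is from having weight -2; it lies in V- and is killed by X. *)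
pose w := lie h Y + 2%:R *: Y.
have Xw : lie X w = 0.
  have XY : lie X Y = - h by rewrite lie_anti hE.
  rewrite /w lieDr lie_derivation (lie_anti X h) hX !(lieE, XY) (lie_anti h h) liexx oppr0.
  by lin_ring.
have Hh : lie H0 h = 0.
  by rewrite -hE -(scale0r (lie Y X)) -(addNr 2%:R); apply: eig_lie.
have HhY : eig H0 (- 2%:R) (lie h Y) by apply: eig_commute HY.
have Hw : eig H0 (- 2%:R) w.
  by apply: (linear_predD (eig_linear _ _)) HhY _; apply: (linear_predZ (eig_linear _ _)).
have hw : lie h w = 0.
  have := lie_derivation Y X w.
  by rewrite Xw (minus_abelian F0 grading HY Hw) !lie0r addr0 hE.
have hhY : lie h (lie h Y) = - 2%:R *: lie h Y.
  by move: hw; rewrite /w lieDr lieZr => /eqP; rewrite addr_eq0 scaleNr => /eqP.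
(* [h, Y] has weight -2 and [X, [h, Y]] = 2 h, whence the factor -1/2 in the statement. *)
have XhY : lie X (lie h Y) = 2%:R *: h.
  move: Xw; rewrite /w lieDr lieZr => /eqP; rewrite addr_eq0 => /eqP ->.
  by rewrite (lie_anti X) hE scalerN opprK.
split=> //; first by rewrite lieZr hhY !scalerA mulrC.
by rewrite lie_anti lieZr XhY scalerA mulNr mulVf // scaleN1r opprK.
Qed.

(** Only [[Y, X], X] = 2 X is recorded: being linear in Y, it can be tested on the components of Y
    for the weights of A. *)
Lemma sl2_triple_exists X : eig H0 2%:R X ->
  exists2 Y, eig H0 (- 2%:R) Y & lie (lie Y X) X = 2%:R *: X.
Proof.
move=> HX; have [y Hy xxy] := plus_regular HX.
exists (2%:R *: y); first exact: (linear_predZ (eig_linear _ _)).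
by rewrite !lieZl (lie_anti _ X) (lie_anti y) lieNr opprK xxy.
Qed.

End JacobsonMorozov.

(** * Weights and coroots *)

Section Weights.
Context (F : fieldType) (L : lieType F) (A : {vspace L}).
Local Notation dual := 'Hom(subvs_of A, F^o).
Implicit Types (mu nu lam : dual) (x y a : L).

Definition value mu a : F := mu (vsproj A a).

Lemma valueD mu nu a : value (mu + nu) a = value mu a + value nu a.
Proof. by rewrite /value add_lfunE. Qed.

Lemma valueN mu a : value (- mu) a = - value mu a.
Proof. by rewrite /value opp_lfunE. Qed.

Lemma value_inj mu nu : (forall a, a \in A -> value mu a = value nu a) -> mu = nu.
Proof. by move=> E; apply/lfunP => a; rewrite -[a]vsvalK; apply: E; apply: subvsP. Qed.

Lemma root_spaceE mu x :
  x \in root_space mu <-> forall a, a \in A -> eig a (value mu a) x.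
Proof.
split=> [/root_spaceP mux a aA | mux].
  by rewrite /eig -[in lie a x](vsprojK aA) mux.
by apply/root_spaceP => a; rewrite (mux _ (subvsP a)) /value vsvalK.
Qed.

Lemma root_space_linear mu : linear_pred (fun x => x \in root_space mu).
Proof. by split=> [|a x y xm ym]; [exact: mem0v | rewrite memvD ?memvZ]. Qed.

Lemma root_space_lie mu nu x y :
  x \in root_space mu -> y \in root_space nu -> lie x y \in root_space (mu + nu).
Proof.
rewrite !root_spaceE => xmu ynu a aA; rewrite valueD.
by apply: eig_lie; [exact: xmu | exact: ynu].
Qed.

Lemma root_space_inj mu nu x :
  x \in root_space mu -> x \in root_space nu -> x <> 0 -> mu = nu.
Proof.
rewrite !root_spaceE => xmu xnu x0; apply: value_inj => a aA.
by apply/eqP/negPn/negP => /(eig_inj (xmu a aA) (xnu a aA)).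
Qed.

Lemma root_value mu x a c :
  x \in root_space mu -> a \in A -> eig a c x -> x <> 0 -> value mu a = c.
Proof.
rewrite root_spaceE => xmu aA ax x0.
by apply/eqP/negPn/negP => /(eig_inj (xmu a aA) ax).
Qed.

Lemma root_space_neq0 mu x : x \in root_space mu -> x <> 0 -> root_space mu <> 0%VS.
Proof. by move=> xmu x0 E; apply: x0; apply/eqP; rewrite -memv0 -E. Qed.

Lemma root_space_witness mu : root_space mu <> 0%VS ->
  exists2 x, x \in root_space mu & x <> 0.
Proof.
move=> mu0; exists (vpick (root_space mu)); first exact: memv_pick.
by apply/eqP; rewrite vpick0; apply/eqP.
Qed.

Context (splitA : split_abelian A).

(** The elements of a basis of A are treated one after the other, each refining the previous
    summands into its own eigenvectors. *)
Lemma weight_decomposition (P : L -> Prop) x : linear_pred P ->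
  (forall a u, a \in A -> P u -> P (lie a u)) -> P x ->
  sum_of (fun u => P u /\ exists mu, u \in root_space mu) x.
Proof.
move=> linP AP Px.
have [comA diagA] := splitA.
have dec (s : seq L) : {subset s <= A} ->
    sum_of (fun u => P u /\ forall a, a \in s -> exists c, eig a c u) x.
  elim: s => [|a s IHs] sA; first by apply: sum_of1.
  have aA : a \in A by apply: sA; rewrite inE eqxx.
  apply: sum_of_trans (IHs _) => [u [Pu su]|b bs]; last by apply: sA; rewrite inE bs orbT.
  have [e [e_basis eE]] := diagA a aA.
  have [t /andP[uniq_t _] at0] := eigenbasis_shifts (f := lie a) e_basis eE.
  (* Q contains the vectors with the same eigenvalues as u for the elements already treated, so that
     refining u keeps these eigenvalues. *)
  pose Q w := P w /\ forall b, b \in s -> exists c, eig b c u /\ eig b c w.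
  have uniq_eig b c c' w : u <> 0 -> eig b c u -> eig b c' u -> eig b c w -> eig b c' w.
    move=> u0 bu bu' bw; have -> // : c' = c.
    by apply/eqP/negPn/negP => /(eig_inj bu' bu).
  (* For u = 0 every c is an eigenvalue of u, and Q need not be linear. *)
  have [u0|u0] := classic (u = 0); first by rewrite u0; exact: sum_of0.
  have linQ : linear_pred Q.
    split=> [|d v w [Pv sv] [Pw sw]].
      split=> [|b /su[c bu]]; first exact: linP.1.
      by exists c; split=> //; exact: (eig_linear _ _).1.
    split=> [|b bs]; first exact: linP.2.
    have [c [bu bv]] := sv b bs; have [c' [bu' bw]] := sw b bs.
    exists c; split=> //; apply: (eig_linear _ _).2 => //; exact: uniq_eig bu' bu bw.
  have Qa w : Q w -> Q (lie a w).
    move=> [Pw sw]; split=> [|b bs]; first exact: AP.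
    have [c [bu bw]] := sw b bs; exists c; split=> //.
    by apply: eig_commute bw; apply: comA => //; apply: sA; rewrite inE bs orbT.
  have Qu : Q u by split=> // b /su[c bu]; exists c.
  apply: sum_of_trans (eigenvector_decomposition linQ Qa uniq_t Qu (at0 u)).
  move=> w [[Pw sw] [c _ aw]]; apply: sum_of1; split=> // b.
  by rewrite inE => /orP[/eqP->|/sw[d [_ bw]]]; [exists c | exists d].
apply: sum_of_trans (dec (vbasis A) _) => [u [Pu Au]|a]; last exact: vbasis_mem.
apply: sum_of1; split=> //.
have /fin_all_exists[c cE] : forall i : 'I_(\dim A), exists c, eig (vbasis A)`_i c u.
  by move=> i; apply: Au; apply: mem_nth; rewrite size_tuple.
pose f (a : subvs_of A) : F^o := \sum_i coord (vbasis A) i (vsval a) * c i.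
have f_linear : linear f.
  move=> d v w; rewrite /f scaler_sumr -big_split; apply: eq_bigr => i _ /=.
  by rewrite !linearP /= mulrDl -mulrA.
pose fM := GRing.isLinear.Build F _ _ *:%R f f_linear.
pose fl : {linear _ -> _} := HB.pack f fM.
exists (linfun fl); apply/root_spaceP => a; rewrite lfunE /= /f.
rewrite [in LHS](coord_vbasis (subvsP a)) scaler_suml.
have lie_sum (I : Type) (s : seq I) (g : I -> L) :
    lie (\sum_(i <- s) g i) u = \sum_(i <- s) lie (g i) u.
  by elim: s => [|i s IHs]; rewrite ?big_nil ?lie0l // !big_cons lieDl IHs.
rewrite lie_sum; apply: eq_bigr => i _; rewrite lieZl cE scalerA //.
Qed.

End Weights.

Section Coroots.
Context (F : fieldType) (F0 : [pchar F] =i pred0) (L : lieType F) (H0 : L).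
Context (grading : forall x : L, lie H0 (lie H0 (lie H0 x)) = 4%:R *: lie H0 x).
Context (regular : forall X : L, eig H0 2%:R X ->
  exists2 Y : L, eig H0 (- 2%:R) Y & lie (lie Y X) X = 2%:R *: X).
Context (A : {vspace L}) (maxA : max_split_abelian (Vzero H0) A) (H0A : H0 \in A).
Local Notation dual := 'Hom(subvs_of A, F^o).
Implicit Types (mu nu lam : dual) (x y a h X Y : L).

Lemma splitA : split_abelian A. Proof. by case: maxA. Qed.

Lemma Vzero_eig a : a \in Vzero H0 <-> eig H0 0 a.
Proof. exact: mem_leigenspace. Qed.

Lemma cartan_abelian a b : a \in A -> b \in A -> lie a b = 0.
Proof. by move=> aA bA; apply: splitA.1. Qed.

Lemma cartan_eig0 a : a \in A -> eig H0 0 a.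
Proof. by have [/subvP AV _ _] := maxA; move=> /AV /Vzero_eig. Qed.

(** h commutes with A, lies in g and is diagonalizable together with A, so maximality of A absorbs
    it. *)
Lemma coroot_in_cartan lam X Y h : eig H0 2%:R X -> eig H0 (- 2%:R) Y ->
  sl2_triple Y h X -> X \in root_space lam -> Y \in root_space (- lam) -> h \in A.
Proof.
move=> HX HY triple Xl Yl; have [AV _ maxP] := maxA.
have Ah a : a \in A -> lie a h = 0.
  have [_ _ <-] := triple => aA; rewrite lie_derivation.
  have /root_spaceE /(_ a aA) -> := Xl; have /root_spaceE /(_ a aA) -> := Yl.
  by rewrite valueN !lieE scaleNr addNr.
suff <- : (A + <[h]>)%VS = A by rewrite memvE addvSr.
apply: maxP; first exact: addvSl.
  by rewrite subv_add AV -memvE; apply/Vzero_eig/(sl2_h0 HX HY triple).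
split=> [x y /memv_addP[a aA [_ /vlineP[c ->] ->]] /memv_addP[b bA [_ /vlineP[d ->] ->]]|].
  by rewrite !lieE cartan_abelian // (lie_anti h b) (Ah a) // (Ah b) // liexx oppr0 !scaler0 !addr0.
move=> x /memv_addP[a aA [_ /vlineP[c ->] ->]].
apply: sum_of_basis => v.
have hint := sl2_integral_decomposition F0 grading HX HY triple (P := fun _ => True) (x := v).
apply: sum_of_trans (hint _ _ _) => // u [_ [n hu]].
apply: sum_of_trans (weight_decomposition splitA (P := eig h n%:~R) _ _ hu).
- move=> w [hw [mu /root_spaceE muw]]; apply: sum_of1.
  by exists (value mu a + c * n%:~R); rewrite !lieE hw muw // scalerA -scalerDl.
- exact: eig_linear.
by move=> b w bA; apply: eig_commute; rewrite lie_anti Ah ?oppr0.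
Qed.

(** A predicate, since h depends a priori on X and Y; [coroot_unique] shows that ad h does not. *)
Definition coroot lam h : Prop :=
  h \in A /\ exists X Y, [/\ X \in root_space lam, Y \in root_space (- lam),
                            X <> 0 & sl2_triple Y h X].

Lemma root_space_eig lam X c : X \in root_space lam -> value lam H0 = c -> eig H0 c X.
Proof. by move=> /root_spaceE Xl <-; exact: Xl. Qed.

(** Some weight component u of the Y0 given by [regular] has [[u, X], X] nonzero. This bracket is a
    multiple of X, so u has weight - lam, and a rescaling of u gives the triple. *)
Lemma coroot_through lam X : X \in root_space lam -> value lam H0 = 2%:R -> X <> 0 ->
  exists Y h, [/\ Y \in root_space (- lam), sl2_triple Y h X & h \in A].
Proof.
move=> Xl l2 X0; have HX := root_space_eig Xl l2.
have [Y0 HY0 Y0X] := regular HX.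
(* The factor 2 is relaxed to any c to obtain a subspace stable under A. *)
pose Q y := eig H0 (- 2%:R) y /\ exists c, lie (lie y X) X = c *: X.
have linQ : linear_pred Q.
  split=> [|a x y [Hx [c xc]] [Hy [d yd]]].
    by split; [exact: (eig_linear _ _).1 | exists 0; rewrite !lie0l scale0r].
  split; first exact: (eig_linear _ _).2.
  by exists (a * c + d); rewrite !lieE xc yd scalerA scalerDl.
have AQ a u : a \in A -> Q u -> Q (lie a u).
  move=> aA [Hu [c uc]]; split; first by apply: eig_commute Hu; exact: cartan_abelian.
  have aX : lie a X = value lam a *: X by have /root_spaceE := Xl; apply.
  exists (- (c * value lam a)).
  have := lie_derivation a (lie u X) X; rewrite uc lieZr aX (lie_derivation a u) aX.
  rewrite !(lieDl, lieZr, lieZl, uc) => E.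
  apply/eqP; rewrite -subr_eq0; apply/eqP.
  rewrite -[RHS](subrr (c *: (value lam a *: X))) {1}E; lin_ring.
have [u [[Hu [c uc]] [mu umu]] cX0] : exists2 u,
    Q u /\ (exists mu, u \in root_space mu) & lie (lie u X) X <> 0.
  apply: NNPP => noE; have : lie (lie Y0 X) X = 0.
    have Q0 : Q Y0 by split=> //; exists 2%:R.
    apply: (sum_of_linear_pred (P := fun y => lie (lie y X) X = 0)) _ _
      (weight_decomposition splitA linQ AQ Q0).
      split=> [|a x y xX yX]; first by rewrite !lie0l.
      by rewrite !lieE xX yX scaler0 addr0.
    by move=> u uE; apply: NNPP => u0; apply: noE; exists u.
  by rewrite Y0X => /(scaler_nat_eq0 F0 (n := 1)).
have c0 : c != 0 by apply/eqP => c0; apply: cX0; rewrite uc c0 scale0r.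
have {}umu : u \in root_space (- lam).
  suff <- : mu = - lam by [].
  have uXX := root_space_lie (root_space_lie umu Xl) Xl.
  have Xl' : lie (lie u X) X \in root_space lam by rewrite uc memvZ.
  have := root_space_inj uXX Xl' cX0 => E.
  by apply/eqP; rewrite -addr_eq0 -(inj_eq (addIr lam)) add0r E.
pose Y := (2%:R / c) *: u.
have HY : eig H0 (- 2%:R) Y by apply: (linear_predZ (eig_linear _ _)).
have YXX : lie (lie Y X) X = 2%:R *: X by rewrite /Y !lieZl uc scalerA divfK.
have triple := sl2_triple_of_regular F0 grading HX HY YXX.
have Yl : Y \in root_space (- lam) by rewrite memvZ.
have Y'l : - 2%:R^-1 *: lie (lie Y X) Y \in root_space (- lam).
  by rewrite memvZ // -[- lam]add0r -{1}(addNr lam); do 2!apply: root_space_lie => //.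
exists (- 2%:R^-1 *: lie (lie Y X) Y), (lie Y X); split=> //.
apply: (coroot_in_cartan HX _ triple Xl Y'l).
by apply: root_space_eig Y'l _; rewrite valueN l2.
Qed.

Lemma coroot_value lam h : coroot lam h -> value lam h = 2%:R.
Proof.
by move=> [hA [X [Y [Xl _ X0 [hX _ _]]]]]; exact: root_value Xl hA hX X0.
Qed.

(* h - h' is orthogonal to both coroots for the trace form and has integral
   eigenvalues. *)
Lemma coroot_unique lam h h' : value lam H0 = 2%:R ->
  coroot lam h -> coroot lam h' -> forall x, lie h x = lie h' x.
Proof.
move=> l2 hl h'l; have lh := coroot_value hl; have lh' := coroot_value h'l.
have [hA [X [Y [Xl Yl X0 triple]]]] := hl.
have [h'A [X' [Y' [X'l Y'l X'0 triple']]]] := h'l.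
have DA : h - h' \in A by rewrite memvB.
have perp Z W : Z \in root_space lam -> W \in root_space (- lam) ->
    trace_form (lie W Z) (h - h') = 0.
  move=> Zl Wl; rewrite trace_form_invariant lie_anti.
  have /root_spaceE /(_ _ DA) -> := Wl.
  have -> : value (- lam) (h - h') = 0.
    by rewrite valueN /value !linearB /= -!/(value _ _) lh lh' subrr oppr0.
  by rewrite scale0r oppr0 trace_formC ((trace_form_linear_pred Z).1) oppr0.
have B0 : trace_form (h - h') (h - h') = 0.
  have [_ _ hE] := triple; have [_ _ h'E] := triple'.
  rewrite -{1}hE -{1}h'E.
  by apply: (linear_predB (trace_form_linear_pred _)); exact: perp.
have HX := root_space_eig Xl l2; have HX' := root_space_eig X'l l2.
have lN2 : value (- lam) H0 = - 2%:R by rewrite valueN l2.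
have HY := root_space_eig Yl lN2; have HY' := root_space_eig Y'l lN2.
suff D0 : ad (h - h') = 0.
  move=> x; have := congr1 (fun f : 'End(L) => f x) D0.
  by rewrite /= adE zero_lfunE lieDl lieNl => /eqP; rewrite subr_eq0 => /eqP.
apply: (lfun_trace_sqr_eq0 F0) B0 => v.
have hint := sl2_integral_decomposition F0 grading HX HY triple (P := fun _ => True) (x := v).
apply: sum_of_trans (hint _ _ _) => // u [_ [n hu]].
have h'int := sl2_integral_decomposition F0 grading HX' HY' triple' (P := eig h n%:~R) (x := u).
apply: sum_of_trans (h'int _ _ _) => //.
- move=> w [hw [m h'w]]; apply: sum_of1; exists (n - m).
  by rewrite adE lieDl lieNl hw h'w -scalerBl intrB.
- exact: eig_linear.
- by move=> w; apply: eig_commute; exact: cartan_abelian.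
Qed.

End Coroots.

(** * The roots of the descent *)

Section DescentRoots.
Context (F : fieldType) (F0 : [pchar F] =i pred0) (L : lieType F) (H0 : L).
Context (grading : forall x : L, lie H0 (lie H0 (lie H0 x)) = 4%:R *: lie H0 x).
Context (regular : forall X : L, eig H0 2%:R X ->
  exists2 Y : L, eig H0 (- 2%:R) Y & lie (lie Y X) X = 2%:R *: X).
Context (A : {vspace L}) (maxA : max_split_abelian (Vzero H0) A) (H0A : H0 \in A).
Local Notation dual := 'Hom(subvs_of A, F^o).
Context (Pi : seq dual) (PiP : is_root_basis Pi).
Context (PiH0 : forall nu, nu \in Pi -> value nu H0 = 0 \/ value nu H0 = 2%:R).
Context (k : nat) (lam : nat -> dual).
Context (simple_lam : forall j, (j <= k)%N -> descent_simple_root Pi lam j (lam j)).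
Context (lamH0 : forall j, (j <= k)%N -> value (lam j) H0 = 2%:R).
Implicit Types (mu nu al : dual) (x y z u v a h X Y : L) (i j l m : nat).

Lemma not_root_space mu : mu <> 0 -> ~ is_root mu -> root_space mu = 0%VS.
Proof. by move=> mu0 nr; apply: NNPP => E; apply: nr. Qed.

Lemma value_neq0 mu a : value mu a != 0 -> mu <> 0.
Proof. by move=> mua E; rewrite E /value zero_lfunE eqxx in mua. Qed.

Let two_neq0 : (2%:R : F) != 0. Proof. exact: (char0_natf_neq0 F0 1). Qed.
Let Ntwo_neq0 : (- 2%:R : F) != 0. Proof. by rewrite oppr_eq0. Qed.

Lemma lam_root j : (j <= k)%N -> root_space (lam j) <> 0%VS.
Proof. by move=> /simple_lam[[[[]]]]. Qed.

Lemma coroot_exists j : (j <= k)%N -> exists h, coroot (lam j) h.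
Proof.
move=> jk; have [X Xl X0] := root_space_witness (lam_root jk).
have [Y [h [Yl triple hA]]] := coroot_through F0 grading regular maxA H0A Xl (lamH0 jk) X0.
by exists h; split=> //; exists X, Y.
Qed.

(** A vector of weight mu is killed by X and Y, because mu + nu and mu - nu, being nonzero and not
    roots, have zero root spaces. *)
Lemma strongly_orthogonal_value mu nu h : strongly_orthogonal mu nu ->
  root_space mu <> 0%VS -> coroot nu h -> value mu h = 0.
Proof.
move=> [mu1 nmu1 mu2 nmu2] /root_space_witness[x xmu x0] [hA [X [Y [Xn Yn _ triple]]]].
apply/eqP/negPn/negP => c0; apply: x0.
have hx : eig h (value mu h) x by have /root_spaceE := xmu; apply.
apply: (sl2_killed triple _ _ hx c0); apply/eqP; rewrite -memv0.
  by rewrite -(not_root_space mu1 nmu1) addrC; apply: root_space_lie.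
by rewrite -(not_root_space mu2 nmu2) addrC; apply: root_space_lie.
Qed.

Lemma lam_orthogonal i m h : (m < i <= k)%N -> coroot (lam m) h -> value (lam i) h = 0.
Proof.
case/andP=> mi ik; have [[_ so] _] := simple_lam ik.
by apply: strongly_orthogonal_value (so m mi) _; exact: lam_root.
Qed.

(** The sum would have degree 4. The difference would have degree 0 and weight -2 for h, against h^3
    = h on g. *)
Lemma strongly_orthogonal_plus mu nu h : value mu H0 = 2%:R -> value nu H0 = 2%:R ->
  coroot nu h -> value mu h = 0 -> strongly_orthogonal mu nu.
Proof.
move=> mu2 nu2 hnu muh; have nuh := coroot_value hnu.
have [hA [X [Y [Xn Yn _ triple]]]] := hnu.
have HX := root_space_eig H0A Xn nu2.
have HY : eig H0 (- 2%:R) Y by apply: (root_space_eig H0A Yn); rewrite valueN nu2.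
split.
- apply: (@value_neq0 _ H0); rewrite valueD mu2 nu2 -natrD.
  exact: (char0_natf_neq0 F0 3).
- move=> [_]; apply; apply/eqP; rewrite -subv0; apply/subvP => x xs; rewrite memv0.
  apply/eqP/(eig4 F0 grading)/(root_space_eig H0A xs).
  by rewrite valueD mu2 nu2 -natrD.
- by apply: (@value_neq0 _ h); rewrite valueD valueN muh nuh add0r.
move=> [_ /root_space_witness[z zs z0]]; apply: z0.
have Hz : eig H0 0 z by apply: (root_space_eig H0A zs); rewrite valueD valueN mu2 nu2 subrr.
have hz : lie h z = - 2%:R *: z.
  by rewrite ((root_spaceE _ _).1 zs) // valueD valueN muh nuh add0r.
have := sl2_cubic_zero F0 grading HX HY triple Hz.
rewrite !(lieE, hz) => E; apply: (scaler_nat_eq0 F0 (n := 5)).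
rewrite -[RHS](subrr (- 2%:R *: z)) -[X in _ = _ - X]E; lin_ring.
Qed.

(** A linear substitute for strong orthogonality to lam 0, ..., lam (j-1). *)
Definition flat j x : Prop :=
  forall i, (i < j)%N -> forall h, coroot (lam i) h -> lie h x = 0.

Definition root_flat j mu : Prop :=
  forall i, (i < j)%N -> forall h, coroot (lam i) h -> value mu h = 0.

Lemma flat_root_flat j mu x : x \in root_space mu -> x <> 0 -> flat j x -> root_flat j mu.
Proof.
move=> xmu x0 fx i ij h hi; have [hA _] := hi.
by apply: root_value xmu hA _ x0; rewrite /eig scale0r; exact: fx hi.
Qed.

(** Named because it is both the conclusion of [two_space_lam] and its induction hypothesis, through
    [strongly_orthogonal_zero]. *)
Definition two_space_root i : Prop := forall mu h, coroot (lam i) h ->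
  root_space mu <> 0%VS -> value mu H0 = 2%:R -> root_flat i mu ->
  value mu h = 2%:R -> mu = lam i.

(** If al + lam l had a nonzero root space, [two_space_root] would force it to equal lam l. A vector
    of weight al - lam l lies in V- with weight -2 for h, and (ad X)^2 embeds it into the space of
    al + lam l. *)
Lemma strongly_orthogonal_zero al l h : (l <= k)%N -> two_space_root l ->
  al <> 0 -> value al H0 = 0 -> root_flat l al -> coroot (lam l) h -> value al h = 0 ->
  strongly_orthogonal al (lam l).
Proof.
move=> lk Sl al0 alH0 fal hl alh; have lh := coroot_value hl; have l2 := lamH0 lk.
have no_sum : root_space (al + lam l) = 0%VS.
  apply: NNPP => ne; apply: al0; apply: (addIr (lam l)); rewrite add0r.
  apply: Sl hl ne _ _ _; rewrite ?valueD ?alH0 ?alh ?add0r //.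
  move=> m ml h' h'm; rewrite valueD (fal m ml) // (lam_orthogonal _ h'm) ?addr0 //.
  by rewrite ml lk.
have [hA [X [Y [Xl Yl _ triple]]]] := hl.
have HX := root_space_eig H0A Xl l2.
have HY : eig H0 (- 2%:R) Y by apply: (root_space_eig H0A Yl); rewrite valueN l2.
split.
- by apply: (@value_neq0 _ H0); rewrite valueD alH0 l2 add0r.
- by move=> [_]; apply.
- by apply: (@value_neq0 _ H0); rewrite valueD valueN alH0 l2 add0r.
move=> [_ /root_space_witness[y ys y0]]; apply: y0.
have Hy : eig H0 (- 2%:R) y.
  by apply: (root_space_eig H0A ys); rewrite valueD valueN alH0 l2 add0r.
have hy : eig h (- 2%:R) y.
  by apply: (root_space_eig hA ys); rewrite valueD valueN alh lh add0r.
apply: (sl2_XX_injective F0 grading HX HY triple Hy hy).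
apply/eqP; rewrite -memv0 -no_sum addrC -[X in lam l + X](subrKC (lam l)).
by do 2!apply: root_space_lie => //; rewrite addrC.
Qed.

(** A nonpositive combination of [Pi] takes a value - n on H0 with n natural, and 2 + n is nonzero
    in characteristic 0. *)
Lemma root_positive mu : root_space mu <> 0%VS -> value mu H0 = 2%:R -> is_pos_root Pi mu.
Proof.
move=> mu_ne mu2; have mur : is_root mu by split=> //; apply: (@value_neq0 _ H0); rewrite mu2.
split=> //; have [_ _ /(_ mu mur)[c [E|E]]] := PiP; first by exists c.
have [n nE] : exists n : nat, value (\sum_(i < size Pi) Pi`_i *+ c i) H0 = n%:R.
  rewrite /value sum_lfunE.
  have : forall i : 'I_(size Pi), exists n : nat, value (Pi`_i *+ c i) H0 = n%:R.
    move=> i; have [E'|E'] := PiH0 (mem_nth 0 (ltn_ord i)).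
      by exists 0%N; rewrite /value -scaler_nat scale_lfunE -/(value _ H0) E' scaler0.
    by exists (c i * 2)%N; rewrite /value -scaler_nat scale_lfunE -/(value _ H0) E' natrM.
  case/fin_all_exists => n nE; exists (\sum_i n i)%N; rewrite natr_sum.
  by apply: eq_bigr => i _; rewrite -nE.
move: mu2; rewrite E valueN nE => /eqP; rewrite -subr_eq0 -opprD oppr_eq0 -natrD.
by rewrite ((pcharf0P F).1 F0) addn2.
Qed.

(* If al = mu - lam i were nonzero, then al, - al and lam i - al would be roots,
   and lam i = (lam i - al) + al = mu + (- al) contradicts simplicity. *)
Lemma two_space_lam i : (i <= k)%N -> two_space_root i.
Proof.
elim/ltn_ind: i => i IH ik mu h hi mu_ne mu2 fmu muh; apply: NNPP => neq.
have l2 := lamH0 ik; have lh := coroot_value hi.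
have [hA [X [Y [Xl Yl _ triple]]]] := hi.
have HX := root_space_eig H0A Xl l2.
have HY : eig H0 (- 2%:R) Y by apply: (root_space_eig H0A Yl); rewrite valueN l2.
pose al := mu - lam i; have al0 : al <> 0 by move/eqP; rewrite subr_eq0 => /eqP.
have alH0 : value al H0 = 0 by rewrite valueD valueN mu2 l2 subrr.
have alh : value al h = 0 by rewrite valueD valueN muh lh subrr.
have fal : root_flat i al.
  move=> m mi h' h'm; rewrite valueD valueN (fmu m mi) // (lam_orthogonal _ h'm) ?subrr //.
  by rewrite mi.
have [x xmu x0] := root_space_witness mu_ne.
have Hx := root_space_eig H0A xmu mu2; have hx := root_space_eig hA xmu muh.
have al_ne : root_space al <> 0%VS.
  apply: (@root_space_neq0 _ _ _ _ (lie Y x)); first by rewrite /al addrC; apply: root_space_lie.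
  by move=> Yx; apply: x0; apply: (sl2_killed triple _ Yx hx two_neq0);
    apply: (plus_abelian F0 grading).
have [y [h' [ymu triple' _]]] := coroot_through F0 grading regular maxA H0A xmu mu2 x0.
have y0 : y <> 0.
  move=> y0; have [hx' _ h'E] := triple'; apply: x0; apply: (scaler_nat_eq0 F0 (n := 1)).
  by rewrite -hx' -h'E y0 !lie0l.
have Hy : eig H0 (- 2%:R) y by apply: (root_space_eig H0A ymu); rewrite valueN mu2.
have hy : eig h (- 2%:R) y by apply: (root_space_eig hA ymu); rewrite valueN muh.
(* This vector has weight 2 lam i - mu = lam i - al. *)
have XXy : lie X (lie X y) <> 0.
  by move/(sl2_XX_injective F0 grading HX HY triple Hy hy).
have Nal_ne : root_space (- al) <> 0%VS.
  apply: (@root_space_neq0 _ _ _ _ (lie X y)); first by rewrite /al opprB; apply: root_space_lie.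
  by move=> Xy; apply: XXy; rewrite Xy lie0r.
have sub_ne : root_space (lam i - al) <> 0%VS.
  apply: (@root_space_neq0 _ _ _ _ (lie X (lie X y))) => //.
  by rewrite /al opprB; do 2!apply: root_space_lie => //.
have [_ simple] := simple_lam ik; apply: simple.
have so_plus nu m : (m < i)%N -> value nu H0 = 2%:R -> root_flat i nu ->
    strongly_orthogonal nu (lam m).
  move=> mi nu2 fnu; have mk := leq_trans (ltnW mi) ik.
  have [h'' h''m] := coroot_exists mk.
  exact: (strongly_orthogonal_plus nu2 (lamH0 mk) h''m (fnu m mi _ h''m)).
(* In degree 0, orthogonality to lam m uses the claim for m, hence the strong induction. *)
have so_zero be m : (m < i)%N -> be <> 0 -> value be H0 = 0 -> root_flat i be ->
    strongly_orthogonal be (lam m).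
  move=> mi be0 beH0 fbe; have mk := leq_trans (ltnW mi) ik.
  have [h'' h''m] := coroot_exists mk.
  apply: (strongly_orthogonal_zero mk (IH m mi mk) be0 beH0 _ h''m (fbe m mi _ h''m)).
  by move=> l lm; apply: fbe; exact: ltn_trans mi.
have al_root : is_root al by [].
(* The sign of al decides which of the two decompositions has positive terms. *)
have [_ _ /(_ al al_root)[c [E|E]]] := PiP.
- exists (lam i - al), al; split; last by rewrite subrK.
    split=> [|m mi]; first by apply: root_positive => //; rewrite valueD valueN l2 alH0 subr0.
    apply: so_plus => //; first by rewrite valueD valueN l2 alH0 subr0.
    move=> l li h'' h''l; rewrite valueD valueN (fal l li) // (lam_orthogonal _ h''l) ?subrr //.
    by rewrite li.
  by split=> [|m mi]; [split=> //; exists c | apply: so_zero].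
have Nal0 : - al <> 0 by move/eqP; rewrite oppr_eq0 => /eqP.
exists mu, (- al); split; last by rewrite /al opprB addrC subrK.
  by split=> [|m mi]; [exact: root_positive | exact: so_plus].
split=> [|m mi]; first by split; [split | exists c; rewrite E opprK].
apply: so_zero => //; first by rewrite valueN alH0 oppr0.
by move=> l li h'' h''l; rewrite valueN (fal l li) // oppr0.
Qed.

Lemma flat_linear j : linear_pred (flat j).
Proof.
split=> [|c x y fx fy] i ij h hi; first by rewrite lie0r.
by rewrite !lieE (fx i ij) // (fy i ij) // scaler0 addr0.
Qed.

Lemma flat_lie j x y : flat j x -> flat j y -> flat j (lie x y).
Proof.
move=> fx fy i ij h hi; rewrite lie_derivation (fx i ij h hi) (fy i ij h hi).
by rewrite lie0l lie0r addr0.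
Qed.

Lemma flat_cartan j a : a \in A -> flat j a.
Proof. by move=> aA i ij h [hA _]; exact: (cartan_abelian maxA). Qed.

Lemma two_space i h v : (i <= k)%N -> coroot (lam i) h -> eig H0 2%:R v -> flat i v ->
  eig h 2%:R v -> v \in root_space (lam i).
Proof.
move=> ik hi Hv fv hv; have [hA _] := hi.
pose P u := [/\ eig H0 2%:R u, flat i u & eig h 2%:R u].
have linP : linear_pred P.
  split=> [|c x y [Hx fx hx] [Hy fy hy]].
    by split; [exact: (eig_linear _ _).1 | exact: (flat_linear _).1 | exact: (eig_linear _ _).1].
  by split; [exact: (eig_linear _ _).2 | exact: (flat_linear _).2 | exact: (eig_linear _ _).2].
have AP a u : a \in A -> P u -> P (lie a u).
  move=> aA [Hu fu hu]; split.
  - by apply: eig_commute Hu; exact: (cartan_abelian maxA).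
  - by apply: flat_lie => //; exact: flat_cartan.
  - by apply: eig_commute hu; exact: (cartan_abelian maxA).
have Pv : P v by [].
apply: (sum_of_linear_pred (root_space_linear _)) (weight_decomposition (splitA maxA) linP AP Pv).
move=> u [[Hu fu hu] [mu umu]]; have [->|u0] := classic (u = 0); first exact: mem0v.
suff <- : mu = lam i by [].
apply: (two_space_lam ik hi); first exact: root_space_neq0 umu u0.
- exact: root_value umu H0A Hu u0.
- exact: flat_root_flat umu u0 fu.
- exact: root_value umu hA hu u0.
Qed.

Lemma lam_flat i x : (i <= k)%N -> x \in root_space (lam i) -> flat i x.
Proof.
move=> ik xl m mi h hm; have [hA _] := hm.
by rewrite ((root_spaceE _ _).1 xl) // (lam_orthogonal _ hm) ?scale0r // mi.
Qed.

(** [z, x] satisfies the conditions of [two_space], so it has weight lam l, although z shifts the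
    eigenvalue of a by c. *)
Lemma weight_vector_kills l z x a c : (l <= k)%N -> x \in root_space (lam l) ->
  eig H0 0 z -> flat l.+1 z -> a \in A -> c != 0 -> eig a c z -> lie z x = 0.
Proof.
move=> lk xl Hz fz aA c0 az; have [h hl] := coroot_exists lk.
have [hA _] := hl; have lh := coroot_value hl.
have zxl : lie z x \in root_space (lam l).
  apply: (two_space lk hl).
  - by rewrite /eig -[2%:R]add0r; apply: eig_lie => //;
      apply: (root_space_eig H0A xl); exact: lamH0.
  - apply: flat_lie; last exact: lam_flat.
    by move=> m ml; apply: fz; exact: ltnW.
  rewrite -[2%:R]add0r; apply: eig_lie; last exact: (root_space_eig hA xl).
  by rewrite /eig scale0r; exact: fz hl.
have ax := (root_spaceE _ _).1 xl a aA.
apply: (eig_inj (eig_lie az ax) ((root_spaceE _ _).1 zxl a aA)).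
by rewrite -subr_eq0 addrK.
Qed.

End DescentRoots.

(** * Elementary automorphisms *)

Section ExpAd.
Context (F : fieldType) (F0 : [pchar F] =i pred0) (L : lieType F).
Implicit Types (a x y z u v w : L) (P : L -> Prop).

(** On an eigenvector of a with eigenvalue d, the iterates of ad z have the eigenvalues j c + d,
    distinct in characteristic 0. At most \dim {:L} eigenvalues are available. *)
Lemma ad_eigenvector_nilpotent a c z : ad_diagonalizable a -> eig a c z -> c != 0 ->
  forall v, iter (\dim {:L}) (lie z) v = 0.
Proof.
move=> [e [e_basis eE]] az c0 v.
have [s /andP[_ size_s] s0] := eigenbasis_shifts (f := lie a) e_basis eE.
have iter_linear n : linear_pred (fun u => iter n (lie z) u = 0).
  have lin d x y : iter n (lie z) (d *: x + y) = d *: iter n (lie z) x + iter n (lie z) y.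
    by elim: n => //= n ->; rewrite !lieE.
  split=> [|d x y x0 y0]; last by rewrite lin x0 y0 scaler0 addr0.
  by elim: n {lin} => //= n ->; rewrite lie0r.
have: v \in <<e>>%VS by rewrite (span_basis e_basis) memvf.
move/(@coord_span _ _ _ (in_tuple e)) ->; apply: (linear_pred_sum (iter_linear _)) => i.
apply: (linear_predZ (iter_linear _)).
have [|d au] := eE (in_tuple e)`_i; first by rewrite mem_nth.
move: (in_tuple e)`_i au => u au; apply: NNPP => un.
have itN0 j : (j <= \dim {:L})%N -> iter j (lie z) u <> 0.
  move=> jn uj; apply: un; rewrite -(subnK jn) iterD uj.
  by elim: (_ - _)%N => //= m ->; rewrite lie0r.
have it_eig j : eig a (j%:R * c + d) (iter j (lie z) u).
  elim: j => [|j IHj]; first by rewrite mul0r add0r.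
  by rewrite -natr1 mulrDl mul1r -addrA (addrC c) addrA [_ + c]addrC; apply: eig_lie.
suff : (\dim {:L} < size s)%N by rewrite ltnNge size_s.
pose t := [seq j%:R * c + d | j <- iota 0 (\dim {:L}).+1].
have -> : (\dim {:L}).+1 = size t by rewrite size_map size_iota.
apply: uniq_leq_size.
  rewrite map_inj_uniq ?iota_uniq // => i1 i2 /addIr /(mulIf c0) /eqP.
  by rewrite !pmulrn => /eqP /(char0_intr_inj F0) [].
move=> x /mapP[j]; rewrite mem_iota => /andP[_ jn] ->.
have := s0 (iter j (lie z) u); rewrite (shifts_eigenvector (f := lie a) _ (it_eig j)).
move/eqP; rewrite scaler_eq0 => /orP[|/eqP /itN0 []//].
by rewrite prodf_seq_eq0 => /hasP[y ys /=]; rewrite subr_eq0 => /eqP ->.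
Qed.

Lemma exp_ad_linear z : linear (exp_ad z).
Proof.
have lin n d x y : iter n (lie z) (d *: x + y) = d *: iter n (lie z) x + iter n (lie z) y.
  by elim: n => //= n ->; rewrite !lieE.
move=> d x y; rewrite /exp_ad scaler_sumr -big_split; apply: eq_bigr => i _ /=.
by rewrite lin scalerDr !scalerA mulrC.
Qed.

Lemma exp_ad_stable P z v : linear_pred P -> (forall u, P u -> P (lie z u)) ->
  P v -> P (exp_ad z v).
Proof.
move=> linP zP Pv; apply: (linear_pred_sum linP) => i; apply: (linear_predZ linP).
by elim: (nat_of_ord i) => //= n; exact: zP.
Qed.

Lemma exp_ad_iter z v m : iter (\dim {:L}) (lie z) v = 0 -> iter m (lie z) v = 0 ->
  exp_ad z v = \sum_(i < m) (i`!%:R : F)^-1 *: iter i (lie z) v.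
Proof.
have extend n p : iter n (lie z) v = 0 ->
    \sum_(i < n + p) (i`!%:R : F)^-1 *: iter i (lie z) v =
    \sum_(i < n) (i`!%:R : F)^-1 *: iter i (lie z) v.
  move=> vn; rewrite big_split_ord /= [X in _ + X]big1 ?addr0 // => i _.
  suff -> : iter (n + i) (lie z) v = 0 by rewrite scaler0.
  by rewrite addnC iterD vn; elim: (nat_of_ord i) => //= q ->; rewrite lie0r.
move=> vd vm; rewrite /exp_ad -(extend _ m vd) -(extend _ (\dim {:L}) vm).
by rewrite addnC.
Qed.

Lemma exp_ad_fixed z v : iter (\dim {:L}) (lie z) v = 0 -> lie z v = 0 -> exp_ad z v = v.
Proof.
move=> vd zv; rewrite (exp_ad_iter (m := 1) vd zv) big_ord_recl big_ord0 addr0 /=.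
by rewrite fact0 invr1 scale1r.
Qed.

(* The top coefficient is eliminated by comparing the values at t and 2t. *)
Lemma polynomial_coefficients P d (w : nat -> L) : linear_pred P ->
  (forall t : F, P (\sum_(i < d) t ^+ i *: w i)) -> forall i, (i < d)%N -> P (w i).
Proof.
move=> linP; elim: d w => [|d IHd] w Pw i //.
have two_inj m n : (2%:R : F) ^+ m = 2%:R ^+ n -> m = n.
  rewrite -!natrX => /eqP; rewrite !pmulrn => /eqP /(char0_intr_inj F0) [].
  by move/eqP; rewrite eqn_exp2l // => /eqP.
have Pj j : (j < d)%N -> P (w j).
  move=> jd; have c0 : (2%:R : F) ^+ j - 2%:R ^+ d != 0.
    by rewrite subr_eq0; apply: contraTneq jd => /two_inj ->; rewrite ltnn.
  rewrite -[w j](scalerK c0); apply: (linear_predZ linP).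
  apply: (IHd (fun j => ((2%:R : F) ^+ j - 2%:R ^+ d) *: w j)) => // t.
  have := linear_predB linP (Pw (2%:R * t)) (linear_predZ linP (2%:R ^+ d) (Pw t)).
  rewrite scaler_sumr -sumrB big_ord_recr /= scalerA -exprMn subrr addr0.
  rewrite (eq_bigr (fun i : 'I_d => t ^+ i *: ((2%:R ^+ i - 2%:R ^+ d) *: w i))) // => m _.
  by rewrite !scalerA -scalerBl exprMn; congr (_ *: _); ring.
rewrite ltnS leq_eqVlt => /orP[/eqP->|]; last exact: Pj.
have := Pw 1; rewrite big_ord_recr /= expr1n scale1r => Pd.
rewrite -[w d](addKr (\sum_(i < d) 1 ^+ i *: w i)) addrC; apply: linear_predB => //.
by apply: (linear_pred_sum linP) => j; apply: (linear_predZ linP); apply: Pj.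
Qed.

(** [z, v] is the coefficient of t in exp (t ad z) v. *)
Lemma exp_ad_stable_lie P z v : linear_pred P ->
  (forall u, iter (\dim {:L}) (lie z) u = 0) ->
  (forall t : F, P (exp_ad (t *: z) v)) -> P (lie z v).
Proof.
move=> linP nilz Pexp; case: (ltnP 1 (\dim {:L})) => d1.
  pose w i := (i`!%:R : F)^-1 *: iter i (lie z) v.
  have /(_ 1%N d1) : forall i, (i < \dim {:L})%N -> P (w i).
    apply: (polynomial_coefficients linP) => t; have := Pexp t; rewrite /exp_ad.
    rewrite (eq_bigr (fun i : 'I__ => t ^+ i *: w i)) // => i _.
    rewrite /w scalerA mulrC -scalerA; congr (_ *: _).
    elim: (nat_of_ord i) => [|n IHn] /=; first by rewrite scale1r.
    by rewrite IHn lieZl lieZr scalerA exprS.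
  by rewrite /w /= invr1 scale1r.
(* In dimension at most 1 the sum in [exp_ad] stops before its linear term, but then nilpotency
   gives ad z = 0. *)
suff -> : lie z v = 0 by exact: linP.1.
rewrite -[lie z v]/(iter 1 (lie z) v) -(subnK d1) iterD nilz.
by elim: (_ - _)%N => //= n ->; rewrite lie0r.
Qed.

Lemma mem_derived (U : {vspace L}) x y : x \in U -> y \in U -> lie x y \in derived U.
Proof.
have linD : linear_pred (fun u : L => u \in derived U).
  by split=> [|a u v uD vD]; [exact: mem0v | rewrite memvD ?memvZ].
move=> xU yU; apply: (linear_pred_span (P := fun u => lie u y \in derived U)) xU.
  by split=> [|a u v uD vD]; [rewrite lie0l mem0v | rewrite !lieE memvD ?memvZ].
move=> i; apply: (linear_pred_span (P := fun u => lie _ u \in derived U)) yU.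
  by split=> [|a u v uD vD]; [rewrite lie0r mem0v | rewrite !lieE memvD ?memvZ].
move=> j; case: (ltnP i (\dim U)) => iU; last first.
  by rewrite nth_default ?size_tuple // lie0l mem0v.
case: (ltnP j (\dim U)) => jU; last first.
  by rewrite [X in lie _ X]nth_default ?size_tuple // lie0r mem0v.
by apply/memv_span/allpairs_f; apply: mem_nth; rewrite size_tuple.
Qed.

Lemma Aut_e_trans (U : {vspace L}) phi psi :
  Aut_e U phi -> Aut_e U psi -> Aut_e U (psi \o phi).
Proof.
move=> Uphi; elim=> [|x {}psi xU nx _ IH] //.
exact: (Aut_e_comp xU nx IH).
Qed.

End ExpAd.

(** * Irreducibility of the layers *)

Section Layers.
Context (F : fieldType) (F0 : [pchar F] =i pred0) (L : lieType F) (H0 : L).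
Context (grading : forall x : L, lie H0 (lie H0 (lie H0 x)) = 4%:R *: lie H0 x).
Context (regular : forall X : L, eig H0 2%:R X ->
  exists2 Y : L, eig H0 (- 2%:R) Y & lie (lie Y X) X = 2%:R *: X).
Context (A : {vspace L}) (maxA : max_split_abelian (Vzero H0) A) (H0A : H0 \in A).
Local Notation dual := 'Hom(subvs_of A, F^o).
Context (Pi : seq dual) (PiP : is_root_basis Pi).
Context (PiH0 : forall nu, nu \in Pi -> value nu H0 = 0 \/ value nu H0 = 2%:R).
Context (k : nat) (lam : nat -> dual).
Context (simple_lam : forall j, (j <= k)%N -> descent_simple_root Pi lam j (lam j)).
Context (lamH0 : forall j, (j <= k)%N -> value (lam j) H0 = 2%:R).
Implicit Types (mu nu al : dual) (x y z u v a h X Y : L) (i j l m : nat).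
Context (irr : forall P : L -> Prop, linear_pred P ->
  (forall x, P x -> eig H0 2%:R x) ->
  (forall z x, eig H0 0 z -> P x -> P (lie z x)) ->
  (exists2 x, P x & x <> 0) -> forall x, eig H0 2%:R x -> P x).

Definition plus_layer j x : Prop := eig H0 2%:R x /\ flat lam j x.
Definition zero_layer j z : Prop := eig H0 0 z /\ flat lam j z.

Lemma plus_layer_linear j : linear_pred (plus_layer j).
Proof.
split=> [|c x y [Hx fx] [Hy fy]].
  by split; [exact: (eig_linear _ _).1 | exact: (flat_linear _ _).1].
by split; [exact: (eig_linear _ _).2 | exact: (flat_linear _ _).2].
Qed.

Lemma zero_layer_linear j : linear_pred (zero_layer j).
Proof.
split=> [|c x y [Hx fx] [Hy fy]].
  by split; [exact: (eig_linear _ _).1 | exact: (flat_linear _ _).1].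
by split; [exact: (eig_linear _ _).2 | exact: (flat_linear _ _).2].
Qed.

Lemma zero_plus_layer j z x : zero_layer j z -> plus_layer j x -> plus_layer j (lie z x).
Proof.
move=> [Hz fz] [Hx fx]; split; last exact: flat_lie.
by rewrite -[2%:R]add0r; apply: eig_lie.
Qed.

Lemma zero_zero_layer j z x : zero_layer j z -> zero_layer j x -> zero_layer j (lie z x).
Proof.
move=> [Hz fz] [Hx fx]; split; last exact: flat_lie.
by rewrite -[X in eig _ X]add0r; apply: eig_lie.
Qed.

Lemma cartan_zero_layer j a : a \in A -> zero_layer j a.
Proof. by move=> aA; split; [exact: (cartan_eig0 maxA) | exact: (flat_cartan maxA)]. Qed.

(** [flat] quantifies over all coroots of lam j; by [coroot_unique] it suffices to test one. *)
Lemma flat_succ j h x : (j <= k)%N -> coroot (lam j) h -> flat lam j x -> lie h x = 0 ->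
  flat lam j.+1 x.
Proof.
move=> jk hj fx hx i; rewrite ltnS leq_eqVlt => /orP[/eqP-> h' h'j|]; last exact: fx.
by rewrite -(coroot_unique F0 grading maxA H0A (lamH0 jk) hj h'j).
Qed.

Lemma flat_pred j x : flat lam j.+1 x -> flat lam j x.
Proof. by move=> fx i ij; apply: fx; exact: ltnW. Qed.

Section OneCoroot.
Context (j : nat) (jk : (j <= k)%N) (h : L) (hj : coroot (lam j) h).

Let two_neq0 : (2%:R : F) != 0. Proof. exact: (char0_natf_neq0 F0 1). Qed.

Let hA : h \in A. Proof. by case: hj. Qed.

Lemma coroot_cubic_plus v : eig H0 2%:R v ->
  lie h (lie h (lie h v)) = 3%:R *: lie h (lie h v) - 2%:R *: lie h v.
Proof.
have [_ [X [Y [Xl Yl _ triple]]]] := hj; have l2 := lamH0 jk.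
have HX := root_space_eig H0A Xl l2.
have HY : eig H0 (- 2%:R) Y by apply: (root_space_eig H0A Yl); rewrite valueN l2.
exact: (sl2_cubic_plus F0 grading HX HY triple).
Qed.

Lemma coroot_cubic_zero z : eig H0 0 z -> lie h (lie h (lie h z)) = lie h z.
Proof.
have [_ [X [Y [Xl Yl _ triple]]]] := hj; have l2 := lamH0 jk.
have HX := root_space_eig H0A Xl l2.
have HY : eig H0 (- 2%:R) Y by apply: (root_space_eig H0A Yl); rewrite valueN l2.
exact: (sl2_cubic_zero F0 grading HX HY triple).
Qed.

Lemma coroot_eig_outside c v : eig H0 2%:R v -> eig h c v ->
  c * (c - 1) * (c - 2%:R) != 0 -> v = 0.
Proof.
move=> Hv hv c0; have := coroot_cubic_plus Hv; rewrite !(hv, lieZr) => E.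
apply/eqP; rewrite -[_ == 0]orFb -(negPf c0) -scaler_eq0; apply/eqP.
rewrite -[RHS](subrr (c *: (c *: (c *: v)))) {2}E.
by apply: coord_inj => i; lin_push; ring.
Qed.

Lemma coroot_eigN1 v : eig H0 2%:R v -> eig h (- 1) v -> v = 0.
Proof.
move=> Hv /(coroot_eig_outside Hv); apply.
rewrite (_ : _ * _ = - 6%:R); last by ring.
by rewrite oppr_eq0; exact: (char0_natf_neq0 F0 5).
Qed.

Lemma coroot_eig3 v : eig H0 2%:R v -> eig h 3%:R v -> v = 0.
Proof.
move=> Hv /(coroot_eig_outside Hv); apply.
rewrite (_ : _ * _ = 6%:R); last by ring.
exact: (char0_natf_neq0 F0 5).
Qed.

Lemma plus_layer_split v : plus_layer j v -> exists v0 v1 v2,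
  [/\ plus_layer j v0 /\ eig h 0 v0, plus_layer j v1 /\ eig h 1 v1,
      plus_layer j v2 /\ eig h 2%:R v2 & v = v0 + v1 + v2].
Proof.
move=> Vv; have cubic := coroot_cubic_plus Vv.1.
have Vh u : plus_layer j u -> plus_layer j (lie h u).
  by apply: zero_plus_layer; exact: cartan_zero_layer.
have [u1 [u1E Vu1]] : exists u1, lie h v = u1 /\ plus_layer j u1 by exists (lie h v); auto.
have [u2 [u2E Vu2]] : exists u2, lie h u1 = u2 /\ plus_layer j u2 by exists (lie h u1); auto.
rewrite u1E u2E in cubic.
have lin := plus_layer_linear j.
(* Lagrange interpolation at 0, 1, 2. *)
exists (v - (3%:R / 2%:R) *: u1 + 2%:R^-1 *: u2), (2%:R *: u1 - u2),
  (2%:R^-1 *: u2 - 2%:R^-1 *: u1).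
split.
- split; first by apply: linear_predD => //; [apply: linear_predB | ] => //;
    apply: linear_predZ.
  by rewrite /eig !(lieDr, lieNr, lieZr) u1E u2E cubic; lin_field.
- split; first by apply: linear_predB => //; apply: linear_predZ.
  by rewrite /eig !(lieDr, lieNr, lieZr) u2E cubic; lin_ring.
- split; first by apply: linear_predB => //; apply: linear_predZ.
  by rewrite /eig !(lieDr, lieNr, lieZr) u2E cubic; lin_field.
by lin_field.
Qed.

Lemma zero_layer_split z : zero_layer j z -> exists zm z0 zp,
  [/\ zero_layer j zm /\ eig h (- 1) zm, zero_layer j z0 /\ eig h 0 z0,
      zero_layer j zp /\ eig h 1 zp & z = zm + z0 + zp].
Proof.
move=> Gz; have cubic := coroot_cubic_zero Gz.1.
have Gh u : zero_layer j u -> zero_layer j (lie h u).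
  by apply: zero_zero_layer; exact: cartan_zero_layer.
have [u1 [u1E Gu1]] : exists u1, lie h z = u1 /\ zero_layer j u1 by exists (lie h z); auto.
have [u2 [u2E Gu2]] : exists u2, lie h u1 = u2 /\ zero_layer j u2 by exists (lie h u1); auto.
rewrite u1E u2E in cubic.
have lin := zero_layer_linear j.
(* Lagrange interpolation at -1, 0, 1. *)
exists (2%:R^-1 *: (u2 - u1)), (z - u2), (2%:R^-1 *: (u2 + u1)).
split.
- split; first by apply: linear_predZ => //; apply: linear_predB.
  by rewrite /eig !(lieDr, lieNr, lieZr) u2E cubic; lin_ring.
- split; first by apply: linear_predB.
  by rewrite /eig !(lieDr, lieNr, lieZr) u1E cubic; lin_ring.
- split; first by apply: linear_predZ => //; apply: linear_predD.
  by rewrite /eig !(lieDr, lieNr, lieZr) u2E cubic; lin_ring.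
by lin_field.
Qed.

(* With m the part of weight -1 for h of the j-th layer of g, the vectors
   v0 + v1 + v2 such that v0, [m, v1] and [m, [m, v2]] lie in W form a submodule
   of the j-th layer. *)
Lemma layer_irreducible_succ :
  (forall P : L -> Prop, linear_pred P -> (forall x, P x -> plus_layer j x) ->
    (forall z x, zero_layer j z -> P x -> P (lie z x)) ->
    (exists2 x, P x & x <> 0) -> forall x, plus_layer j x -> P x) ->
  forall W : L -> Prop, linear_pred W -> (forall x, W x -> plus_layer j.+1 x) ->
    (forall z x, zero_layer j.+1 z -> W x -> W (lie z x)) ->
    (exists2 x, W x & x <> 0) -> forall x, plus_layer j.+1 x -> W x.
Proof.
move=> irr_j W linW WV gW [w Ww w0].
pose gm z := zero_layer j z /\ eig h (- 1) z.
have g0W z x : zero_layer j z -> eig h 0 z -> W x -> W (lie z x).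
  move=> [Hz fz] hz; apply: gW; split=> //; apply: flat_succ hj fz _ => //.
  by rewrite hz scale0r.
have gm0 z v : gm z -> plus_layer j v -> eig h 0 v -> lie z v = 0.
  move=> [Gz hz] Vv hv; apply: coroot_eigN1; first exact: (zero_plus_layer Gz Vv).1.
  by rewrite -[- 1]addr0; apply: eig_lie.
pose T v := plus_layer j v /\ exists v0 v1 v2,
  [/\ plus_layer j v0 /\ eig h 0 v0, plus_layer j v1 /\ eig h 1 v1,
      plus_layer j v2 /\ eig h 2%:R v2, v = v0 + v1 + v2 &
      [/\ W v0, forall z, gm z -> W (lie z v1) &
          forall z z', gm z -> gm z' -> W (lie z (lie z' v2))]].
have V0 : plus_layer j 0 by exact: (plus_layer_linear j).1.
have e0 c : eig h c 0 by exact: (eig_linear _ _).1.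
have W0 : W 0 by exact: linW.1.
have linT : linear_pred T.
  split=> [|c x y].
    split=> //; exists 0, 0, 0; rewrite !addr0; split=> //; split=> // [z _|z z' _ _];
      by rewrite !lie0r.
  move=> [Vx [x0 [x1 [x2 [[Vx0 hx0] [Vx1 hx1] [Vx2 hx2] -> [Wx0 Wx1 Wx2]]]]]].
  move=> [Vy [y0 [y1 [y2 [[Vy0 hy0] [Vy1 hy1] [Vy2 hy2] -> [Wy0 Wy1 Wy2]]]]]].
  have lin := plus_layer_linear j; split; first by apply: lin.2; do !apply: linear_predD => //.
  exists (c *: x0 + y0), (c *: x1 + y1), (c *: x2 + y2); split.
  - by split; [exact: lin.2 | exact: (eig_linear _ _).2].
  - by split; [exact: lin.2 | exact: (eig_linear _ _).2].
  - by split; [exact: lin.2 | exact: (eig_linear _ _).2].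
  - by lin_ring.
  split; first exact: linW.2.
  - by move=> z gz; rewrite !lieE; apply: linW.2; auto.
  - by move=> z z' gz gz'; rewrite !lieE; apply: linW.2; auto.
have TT : forall x v, zero_layer j x -> T v -> T (lie x v).
  move=> x v Gx [Vv [v0 [v1 [v2 [[Vv0 hv0] [Vv1 hv1] [Vv2 hv2] -> [Wv0 Wv1 Wv2]]]]]].
  have [xm [x0 [xp [[Gm hm] [Gz hz] [Gp hp] ->]]]] := zero_layer_split Gx.
  rewrite !(lieDl _ _ (v0 + v1 + v2)).
  have Vvv : plus_layer j (v0 + v1 + v2).
    by do !apply: (linear_predD (plus_layer_linear j)) => //.
  have gg0 z y : gm z -> zero_layer j y -> eig h 0 y -> gm (lie z y).
    move=> [Gz1 hz1] Gy hy; split; first exact: zero_zero_layer.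
    by rewrite -[- 1]addr0; apply: eig_lie.
  (* [z, y] has weight 0 for h, so it lies in the next layer of g and preserves W. This absorbs the
     commutators created by raising elements. *)
  have ggp z y v' : gm z -> zero_layer j y -> eig h 1 y -> W v' -> W (lie (lie z y) v').
    move=> [Gz1 hz1] Gy hy; apply: g0W; first exact: zero_zero_layer.
    by rewrite -[X in eig _ X](addNr 1); apply: eig_lie.
  have gWv z : gm z -> W (lie z v0) by move=> gz; rewrite gm0.
  apply: (linear_predD linT); first apply: (linear_predD linT).
  - split; first exact: zero_plus_layer.
    exists (lie xm v1), (lie xm v2), 0; split.
    + split; first exact: zero_plus_layer.
      by rewrite -[X in eig _ X](addNr 1); apply: eig_lie.
    + split; first exact: zero_plus_layer.
      by rewrite (_ : 1 = - 1 + 2%:R); [apply: eig_lie | ring].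
    + by [].
    + by rewrite !lieDr (gm0 xm v0) // add0r addr0.
    split=> [|z gz|z z' _ _]; [exact: Wv1 | exact: Wv2 | by rewrite !lie0r].
  - split; first exact: zero_plus_layer.
    exists (lie x0 v0), (lie x0 v1), (lie x0 v2); split.
    + by split; [exact: zero_plus_layer | rewrite -[X in eig _ X]add0r; apply: eig_lie].
    + by split; [exact: zero_plus_layer | rewrite -[1]add0r; apply: eig_lie].
    + by split; [exact: zero_plus_layer | rewrite -[2%:R]add0r; apply: eig_lie].
    + by rewrite !lieDr.
    split=> [|z gz|z z' gz gz']; first exact: g0W.
      rewrite (lie_derivation z); apply: (linear_predD linW).
        by apply: Wv1; exact: gg0.
      by apply: g0W => //; exact: Wv1.
    rewrite (lie_derivation z') lieDr; apply: (linear_predD linW).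
      by apply: Wv2 => //; exact: gg0.
    rewrite (lie_derivation z); apply: (linear_predD linW).
      by apply: Wv2 => //; exact: gg0.
    by apply: g0W => //; exact: Wv2.
  split; first exact: zero_plus_layer.
  exists 0, (lie xp v0), (lie xp v1); split=> //.
  - by split; [exact: zero_plus_layer | rewrite -[1]addr0; apply: eig_lie].
  - by split; [exact: zero_plus_layer | rewrite -[2%:R]/(1 + 1); apply: eig_lie].
  - rewrite !lieDr add0r (_ : lie xp v2 = 0) ?addr0 //; apply: coroot_eig3.
      exact: (zero_plus_layer Gp Vv2).1.
    by rewrite (_ : 3%:R = 1 + 2%:R); [apply: eig_lie | ring].
  split=> // [z gz|z z' gz gz'].
    by rewrite (lie_derivation z) (gm0 z v0) // lie0r addr0; apply: ggp.
  rewrite (lie_derivation z') lieDr; apply: (linear_predD linW).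
    rewrite (lie_derivation z); apply: (linear_predD linW).
      apply: Wv1; apply: gg0 => //.
        exact: zero_zero_layer gz'.1 Gp.
      by rewrite -[X in eig _ X](addNr 1); apply: eig_lie; [case: gz'|].
    by apply: ggp => //; exact: Wv1.
  rewrite (lie_derivation z); apply: (linear_predD linW).
    by apply: ggp => //; exact: Wv1.
  rewrite (gm0 z (lie z' v1)) ?lie0r //; first exact: zero_plus_layer gz'.1 Vv1.
  by rewrite -[X in eig _ X](addNr 1); apply: eig_lie; [case: gz'|].
have layerS x : plus_layer j.+1 x -> plus_layer j x /\ eig h 0 x.
  move=> [Hx fx]; split; first by split=> //; exact: flat_pred.
  by rewrite /eig scale0r; exact: fx hj.
have Tw : T w.
  have [Vw hw] := layerS w (WV w Ww); split=> //; exists w, 0, 0.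
  by rewrite !addr0; split=> //; split=> // [z _|z z' _ _]; rewrite !lie0r.
have Tall : forall x, plus_layer j x -> T x.
  by apply: irr_j linT _ TT _; [move=> x [] | exists w].
(* x has weight 0: comparing [h, x] = 0 with [h, [h, x]] = 0 gives v2 = 0, then v1 = 0, so x = v0 is
   in W. *)
move=> x /layerS[/Tall[_ [v0 [v1 [v2 [[_ hv0] [_ hv1] [_ hv2] -> [Wv0 _ _]]]]]]].
rewrite /eig !lieDr hv0 hv1 hv2 => E.
have := congr1 (lie h) E; rewrite !lieE hv0 hv1 hv2 => E2.
have v2_0 : v2 = 0.
  apply: (scaler_nat_eq0 F0 (n := 1)).
  have : 2%:R *: v2 = (0 *: (0 *: v0) + 1 *: (1 *: v1) + 2%:R *: (2%:R *: v2)) -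
     (0 *: v0 + 1 *: v1 + 2%:R *: v2) by lin_ring.
  by rewrite E E2 !scale0r subrr.
by move: E; rewrite v2_0 !scale0r scaler0 add0r !addr0 scale1r => ->; rewrite addr0.
Qed.

End OneCoroot.
End Layers.

(** * Reduction to the root spaces *)

Section Motion.
Context (F : fieldType) (F0 : [pchar F] =i pred0) (L : lieType F) (H0 : L).
Context (grading : forall x : L, lie H0 (lie H0 (lie H0 x)) = 4%:R *: lie H0 x).
Context (regular : forall X : L, eig H0 2%:R X ->
  exists2 Y : L, eig H0 (- 2%:R) Y & lie (lie Y X) X = 2%:R *: X).
Context (A : {vspace L}) (maxA : max_split_abelian (Vzero H0) A) (H0A : H0 \in A).
Local Notation dual := 'Hom(subvs_of A, F^o).
Context (Pi : seq dual) (PiP : is_root_basis Pi).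
Context (PiH0 : forall nu, nu \in Pi -> value nu H0 = 0 \/ value nu H0 = 2%:R).
Context (k : nat) (lam : nat -> dual).
Context (simple_lam : forall j, (j <= k)%N -> descent_simple_root Pi lam j (lam j)).
Context (lamH0 : forall j, (j <= k)%N -> value (lam j) H0 = 2%:R).
Implicit Types (mu nu al : dual) (x y z u v a h X Y : L) (i j l m : nat).
Context (irr : forall P : L -> Prop, linear_pred P ->
  (forall x, P x -> eig H0 2%:R x) ->
  (forall z x, eig H0 0 z -> P x -> P (lie z x)) ->
  (exists2 x, P x & x <> 0) -> forall x, eig H0 2%:R x -> P x).

Local Notation plus_layer := (plus_layer H0 lam).
Local Notation zero_layer := (zero_layer H0 lam).

Lemma layer_irreducible j : (j <= k.+1)%N -> forall P : L -> Prop, linear_pred P ->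
  (forall x, P x -> plus_layer j x) ->
  (forall z x, zero_layer j z -> P x -> P (lie z x)) ->
  (exists2 x, P x & x <> 0) -> forall x, plus_layer j x -> P x.
Proof.
elim: j => [_ P linP PV gP nzP x [Hx _]|j IHj jk].
  apply: irr => // [y /PV[] //|z y Hz]; apply: gP; by split.
have [h hj] := coroot_exists F0 grading regular maxA H0A simple_lam lamH0 jk.
exact: (layer_irreducible_succ F0 grading maxA H0A lamH0 jk hj (IHj (ltnW jk))).
Qed.

(** One a in A with a nonzero eigenvalue suffices: it makes ad z nilpotent and puts z = [a, z] / c
    in [g, g]. *)
Definition mover j z : Prop :=
  zero_layer j z /\ exists a c, [/\ a \in A, c != 0 & eig a c z].

Lemma mover_nilpotent j z : mover j z -> forall v, iter (\dim {:L}) (lie z) v = 0.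
Proof.
move=> [_ [a [c [aA c0 az]]]].
exact: (ad_eigenvector_nilpotent F0 ((splitA maxA).2 a aA) az c0).
Qed.

Lemma mover_Aut_e j z : mover j z -> Aut_e (Vzero H0) (exp_ad z).
Proof.
move=> mz; have [[Hz _] [a [c [aA c0 az]]]] := mz.
apply: (Aut_e_comp (phi := id)); last exact: Aut_e_id.
  rewrite -[z](scalerK c0) -az memvZ // mem_derived //; last exact/Vzero_eig.
  by apply/Vzero_eig; exact: (cartan_eig0 maxA).
by exists (\dim {:L}) => y _; exact: mover_nilpotent mz y.
Qed.

Lemma moverZ j z t : mover j z -> mover j (t *: z).
Proof.
move=> [Gz [a [c [aA c0 az]]]]; split; first exact: (linear_predZ (zero_layer_linear _ _ _)).
by exists a, c; split=> //; exact: (linear_predZ (eig_linear _ _)).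
Qed.

Lemma mover_fixes j z l x : (l < j <= k.+1)%N -> mover j z -> x \in root_space (lam l) ->
  exp_ad z x = x.
Proof.
case/andP=> lj jk mz xl; have [[Hz fz] [a [c [aA c0 az]]]] := mz.
apply: exp_ad_fixed; first exact: mover_nilpotent mz x.
apply: (weight_vector_kills F0 grading regular maxA H0A PiP PiH0 simple_lam lamH0
  _ xl Hz _ aA c0 az).
  by rewrite -ltnS (leq_trans lj jk).
by move=> i il; apply: fz; exact: leq_trans il lj.
Qed.

Section OneStep.
Context (j : nat) (jk : (j <= k)%N) (h : L) (hj : coroot (lam j) h).

Let two_neq0 : (2%:R : F) != 0. Proof. exact: (char0_natf_neq0 F0 1). Qed.

Let hA : h \in A. Proof. by case: hj. Qed.

(* On the j-th layer this is twice the projection onto its component of weight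
   2 for h, that is, onto root_space (lam j). *)
Definition top u : L := lie h (lie h u) - lie h u.

Lemma top_linear : linear top.
Proof. by move=> c x y; rewrite /top !lieE; lin_ring. Qed.

Lemma top_lie z u : lie h z = 0 -> top (lie z u) = lie z (top u).
Proof.
move=> hz; have C v : lie h (lie z v) = lie z (lie h v).
  by rewrite lie_derivation hz lie0l add0r.
by rewrite /top !C lieDr lieNr.
Qed.

Definition brackets zs v : L := foldr (fun z u => lie z u) v zs.

Lemma brackets_linear zs c x y :
  brackets zs (c *: x + y) = c *: brackets zs x + brackets zs y.
Proof. by elim: zs => //= z zs ->; rewrite !lieE. Qed.

Definition movers (zs : seq L) : Prop := forall z, z \in zs -> mover j z.

(* The vectors for which no product of brackets, hence no product of
   exponentials, reaches the root space of lam j. *)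
Definition untouched v : Prop :=
  plus_layer j v /\ forall zs, movers zs -> top (brackets zs v) = 0.

Lemma untouched_linear : linear_pred untouched.
Proof.
split=> [|c x y [Vx tx] [Vy ty]].
  split=> [|zs _]; first exact: (plus_layer_linear _ _ _).1.
  have -> : brackets zs 0 = 0 by elim: zs => //= z zs ->; rewrite lie0r.
  by rewrite /top !lie0r subrr.
split=> [|zs mzs]; first exact: (plus_layer_linear _ _ _).2.
by rewrite brackets_linear top_linear tx // ty // scaler0 addr0.
Qed.

Lemma untouched_mover z v : mover j z -> untouched v -> untouched (lie z v).
Proof.
move=> mz [Vv tv]; split; first by apply: zero_plus_layer Vv; case: mz.
move=> zs mzs; have := tv (rcons zs z); rewrite /brackets foldr_rcons; apply.
by move=> y; rewrite mem_rcons inE => /orP[/eqP->|/mzs].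
Qed.

Lemma mover_bracket z (m : L) : zero_layer j m -> (forall a, a \in A -> lie a m = 0) ->
  mover j z -> mover j (lie z m).
Proof.
move=> Gm Am [Gz [a [c [aA c0 az]]]]; split; first exact: zero_zero_layer.
exists a, c; split=> //; rewrite -[c]addr0; apply: eig_lie az _.
by rewrite /eig scale0r Am.
Qed.

(* The centralizer of A is moved to the left through the brackets. *)
Lemma untouched_centralizer (m : L) v : zero_layer j m -> (forall a, a \in A -> lie a m = 0) ->
  untouched v -> untouched (lie m v).
Proof.
move=> Gm Am uv; have [Vv _] := uv; split; first exact: zero_plus_layer.
move=> zs mzs; elim/last_ind: zs v uv {Vv} mzs => [|zs z IHzs] v uv mzs.
  rewrite /= top_lie; last exact: Am.
  by have [_ /(_ [::]) /= -> //] := uv; rewrite ?lie0r.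
have mz : mover j z by apply: mzs; rewrite mem_rcons inE eqxx.
have mzs' : movers zs by move=> y yzs; apply: mzs; rewrite mem_rcons inE yzs orbT.
rewrite /brackets foldr_rcons -/(brackets zs _) (lie_derivation z) -[lie (lie z m) v]scale1r.
rewrite brackets_linear top_linear (IHzs (lie z v)) ?addr0 //; last exact: untouched_mover.
have [_ ->] := untouched_mover (mover_bracket Gm Am mz) uv; last by [].
by rewrite scaler0.
Qed.

(** By weights for A, an element of the layer is a sum of movers and of elements centralizing A. *)
Lemma untouched_zero_layer x v : zero_layer j x -> untouched v -> untouched (lie x v).
Proof.
move=> Gx uv.
have AG a u : a \in A -> zero_layer j u -> zero_layer j (lie a u).
  by move=> aA; apply: zero_zero_layer; exact: (cartan_zero_layer maxA).
have linP : linear_pred (fun z => untouched (lie z v)).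
  split=> [|c y z uy uz]; first by rewrite lie0l; exact: untouched_linear.1.
  by rewrite !lieE; exact: untouched_linear.2.
apply: (sum_of_linear_pred linP)
  (weight_decomposition (splitA maxA) (zero_layer_linear _ _ _) AG Gx).
move=> u [Gu [mu umu]]; have muE a := (root_spaceE _ _).1 umu a.
case: (classic (exists2 a, a \in A & value mu a != 0)) => [[a aA mua]|mu0].
  by apply: untouched_mover => //; split=> //; exists a, (value mu a); split=> //; exact: muE.
apply: untouched_centralizer => // a aA; rewrite (muE a aA).
by have [->|mua] := eqVneq (value mu a) 0; [rewrite scale0r | case: mu0; exists a].
Qed.

(** Otherwise irreducibility makes the whole layer untouched, but [top] multiplies a root vector for
    lam j by 2. *)
Lemma untouched_eq0 v : untouched v -> v = 0.
Proof.
move=> uv; apply: NNPP => v0.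
have all_untouched := layer_irreducible (leqW jk) untouched_linear
  (fun x => @proj1 _ _) untouched_zero_layer (ex_intro2 _ _ v uv v0).
have [X Xl X0] := root_space_witness (lam_root simple_lam jk).
have VX : plus_layer j X.
  split; first exact: (root_space_eig H0A Xl (lamH0 jk)).
  exact: (lam_flat simple_lam jk Xl).
have [_ /(_ [::]) /= tX] := all_untouched X VX.
have hX : lie h X = 2%:R *: X.
  by rewrite ((root_spaceE _ _).1 Xl) // (coroot_value hj).
apply: X0; apply: (scaler_nat_eq0 F0 (n := 1)).
by rewrite -tX // /top !(hX, lieZr); lin_ring.
Qed.

Definition exps zs v : L := foldr (fun z u => exp_ad z u) v zs.

Lemma exps_linear zs c x y : exps zs (c *: x + y) = c *: exps zs x + exps zs y.
Proof. by elim: zs => //= z zs ->; rewrite exp_ad_linear. Qed.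

Lemma exps0 zs : exps zs 0 = 0.
Proof. by have := exps_linear zs (- 1) 0 0; rewrite scaler0 addr0 scaleN1r addNr. Qed.

Lemma exps_plus_layer zs v : movers zs -> plus_layer j v -> plus_layer j (exps zs v).
Proof.
move=> mzs Vv; elim: zs mzs => //= z zs IHzs mzs.
apply: exp_ad_stable; first exact: plus_layer_linear.
  by move=> u; apply: zero_plus_layer; have [] := mzs z (mem_head _ _).
by apply: IHzs => y yzs; apply: mzs; rewrite inE yzs orbT.
Qed.

Lemma exps_Aut_e zs : movers zs -> Aut_e (Vzero H0) (exps zs).
Proof.
elim: zs => [|z zs IHzs] mzs; first exact: Aut_e_id.
apply: (Aut_e_trans (phi := exps zs) (psi := exp_ad z)).
  by apply: IHzs => y yzs; apply: mzs; rewrite inE yzs orbT.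
by apply: (@mover_Aut_e j); apply: mzs; exact: mem_head.
Qed.

Lemma exps_fixes zs l x : (l < j)%N -> movers zs -> x \in root_space (lam l) -> exps zs x = x.
Proof.
move=> lj mzs xl; elim: zs mzs => //= z zs IHzs mzs.
rewrite IHzs => [|y yzs]; last by apply: mzs; rewrite inE yzs orbT.
by apply: (mover_fixes (j := j) (l := l)); rewrite ?lj ?leqW //; apply: mzs; exact: mem_head.
Qed.

(** The vectors that no product of exponentials moves to a nonzero [top] are stable under every exp
    (t ad z), hence under brackets with movers; thus they are untouched. *)
Lemma exps_top v : plus_layer j v -> v <> 0 ->
  exists2 zs, movers zs & top (exps zs v) <> 0.
Proof.
move=> Vv v0; apply: NNPP => noE; apply: v0; apply: untouched_eq0.
pose M u := plus_layer j u /\ forall zs, movers zs -> top (exps zs u) = 0.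
have linM : linear_pred M.
  split=> [|c x y [Vx tx] [Vy ty]].
    split=> [|zs _]; first exact: (plus_layer_linear _ _ _).1.
    by rewrite exps0 /top !lie0r subrr.
  split=> [|zs mzs]; first exact: (plus_layer_linear _ _ _).2.
  by rewrite exps_linear top_linear tx // ty // scaler0 addr0.
have Mexp z u : mover j z -> M u -> M (exp_ad z u).
  move=> mz [Vu tu]; split.
    apply: (exps_plus_layer (zs := [:: z])) => // y; rewrite inE => /eqP->; exact: mz.
  move=> zs mzs; have := tu (rcons zs z); rewrite /exps foldr_rcons; apply.
  by move=> y; rewrite mem_rcons inE => /orP[/eqP->|/mzs].
have Mlie z u : mover j z -> M u -> M (lie z u).
  move=> mz Mu; apply: exp_ad_stable_lie => //; first exact: mover_nilpotent mz.
  by move=> t; apply: Mexp => //; exact: moverZ.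
have Mv : M v by split=> // zs mzs; apply: NNPP => t0; apply: noE; exists zs.
split=> // zs mzs; have [_ /(_ [::]) /= ->] // : M (brackets zs v).
elim: zs mzs => //= z zs IHzs mzs; apply: Mlie; first by apply: mzs; exact: mem_head.
by apply: IHzs => y yzs; apply: mzs; rewrite inE yzs orbT.
Qed.

(* If x is the component of weight 2 of v and y the one of weight 1, then
   z = - [Y, y], for an sl2-triple (Y, h', x), satisfies [z, x] = - y. *)
Lemma clear_weight1 v : plus_layer j v -> top v <> 0 ->
  exists z x w, [/\ mover j z, x \in root_space (lam j), plus_layer j.+1 w &
                  exp_ad z v = x + w].
Proof.
move=> Vv tv.
have [v0 [v1 [v2 [[Vv0 hv0] [Vv1 hv1] [Vv2 hv2] vE]]]] :=
  plus_layer_split F0 grading maxA H0A lamH0 jk hj Vv.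
have v2_neq0 : v2 <> 0.
  move=> v20; apply: tv; rewrite /top vE v20 addr0 !(lieDr, hv0, hv1, lieZr).
  by lin_ring.
have v2l : v2 \in root_space (lam j).
  have [Hv2 fv2] := Vv2.
  exact: (two_space F0 grading regular maxA H0A PiP PiH0 simple_lam lamH0 jk hj).
have [Y [h' [Yl triple h'A]]] :=
  coroot_through F0 grading regular maxA H0A v2l (lamH0 jk) v2_neq0.
have h'j : coroot (lam j) h' by split=> //; exists v2, Y.
(* The triple through v2 brings its own coroot; both act alike, so the weights for h apply to it. *)
have hh' u : lie h' u = lie h u := coroot_unique F0 grading maxA H0A (lamH0 jk) h'j hj u.
have HY : eig H0 (- 2%:R) Y by apply: (root_space_eig H0A Yl); rewrite valueN lamH0.
have hY : eig h (- 2%:R) Y.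
  by apply: (root_space_eig hA Yl); rewrite valueN (coroot_value hj).
have fY : flat lam j Y.
  move=> i ij g gi; have [gA _] := gi; rewrite ((root_spaceE _ _).1 Yl) // valueN.
  by rewrite (lam_orthogonal simple_lam _ gi) ?ij // oppr0 scale0r.
pose z := - lie Y v1.
have Gz : zero_layer j z.
  apply: (linear_predN (zero_layer_linear _ _ _)); split; last by apply: flat_lie => //; case: Vv1.
  by rewrite /eig -(addNr 2%:R); apply: eig_lie => //; case: Vv1.
have hz : eig h (- 1) z.
  apply: (linear_predN (eig_linear _ _)); rewrite (_ : - 1 = - 2%:R + 1); last by ring.
  exact: eig_lie.
have mz : mover j z by split=> //; exists h, (- 1); rewrite oppr_eq0 oner_neq0.
have zv0 : lie z v0 = 0.
  apply: (coroot_eigN1 F0 grading H0A lamH0 jk hj); first exact: (zero_plus_layer Gz Vv0).1.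
  by rewrite -[- 1]addr0; apply: eig_lie.
have Vzv1 : plus_layer j (lie z v1) by exact: zero_plus_layer.
have hzv1 : eig h 0 (lie z v1) by rewrite -[X in eig _ X](addNr 1); apply: eig_lie.
have zzv1 : lie z (lie z v1) = 0.
  apply: (coroot_eigN1 F0 grading H0A lamH0 jk hj); first exact: (zero_plus_layer Gz Vzv1).1.
  by rewrite -[- 1]addr0; apply: eig_lie.
have zv2 : lie z v2 = - v1.
  have [_ _ Yv2] := triple.
  rewrite /z lieNl; congr (- _); rewrite lie_anti lie_derivation (lie_anti v2 Y) Yv2.
  rewrite (plus_abelian F0 grading Vv2.1 Vv1.1) lie0r addr0 lieNl opprK hh'.
  by rewrite hv1 scale1r.
have zv : lie z v = lie z v1 - v1 by rewrite vE !lieDr zv0 zv2 add0r.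
have zzv : lie z (lie z v) = - lie z v1 by rewrite zv lieDr lieNr zzv1 add0r.
have zzzv : iter 3 (lie z) v = 0 by rewrite /= zzv lieNr zzv1 oppr0.
(* The exponential stops at order 2: [z, v] = [z, v1] - v1 cancels v1, and the quadratic term -
   [z, v1] / 2 leaves half of [z, v1]. *)
exists z, v2, (v0 + 2%:R^-1 *: lie z v1); split=> //.
  have Vw : plus_layer j (v0 + 2%:R^-1 *: lie z v1).
    by apply: (linear_predD (plus_layer_linear _ _ _)) => //;
      apply: (linear_predZ (plus_layer_linear _ _ _)).
  have [Hw fw] := Vw; split=> //.
  apply: (flat_succ F0 grading maxA H0A lamH0 jk hj fw).
  by rewrite lieDr lieZr hv0 hzv1 !scale0r scaler0 addr0.
rewrite (exp_ad_iter (mover_nilpotent mz v) zzzv) !big_ord_recl big_ord0 /=.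
rewrite /bump /= zzv zv vE !addn0 add1n !factS fact0 !muln1 !invr1.
by move: (lie z v1) => t; lin_field.
Qed.

End OneStep.

Lemma reduction j X : (j <= k.+1)%N -> eig H0 2%:R X ->
  exists phi x w, [/\ Aut_e (Vzero H0) phi, x \in (\sum_(i < j) root_space (lam i))%VS,
                    plus_layer j w & phi X = x + w].
Proof.
move=> + HX; elim: j => [_|j IHj jk].
  by exists id, 0, X; split; rewrite ?add0r ?mem0v //; exact: Aut_e_id.
have [phi [x [w [Aphi xs Vw phiX]]]] := IHj (ltnW jk).
have sum_succ y z : y \in (\sum_(i < j) root_space (lam i))%VS -> z \in root_space (lam j) ->
    y + z \in (\sum_(i < j.+1) root_space (lam i))%VS.
  by move=> ys zl; rewrite big_ord_recr /=; exact: memv_add.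
have [w0|w0] := classic (w = 0).
  exists phi, x, 0; split=> //; last by rewrite phiX w0.
    by rewrite -[x]addr0; apply: sum_succ; rewrite ?mem0v.
  exact: (plus_layer_linear _ _ _).1.
have [h hj] := coroot_exists F0 grading regular maxA H0A simple_lam lamH0 jk.
have [zs mzs tw] := exps_top jk hj Vw w0.
have [z [x' [w' [mz x'l Vw' zE]]]] := clear_weight1 jk hj (exps_plus_layer mzs Vw) tw.
have mzzs : movers j (z :: zs) by move=> y; rewrite inE => /orP[/eqP->|/mzs].
exists (exps (z :: zs) \o phi), (x + x'), w'; split=> //.
- by apply: Aut_e_trans Aphi _; exact: (exps_Aut_e mzzs).
- exact: sum_succ.
have fix_x : exps (z :: zs) x = x.
  have /memv_sumP[f fl ->] := xs; elim/big_ind: _ => [|y y' yE y'E|i _]; first exact: exps0.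
    by rewrite -[y]scale1r exps_linear yE y'E.
  exact: (exps_fixes jk (ltn_ord i) mzzs (fl i isT)).
have := exps_linear (z :: zs) 1 x w; rewrite !scale1r fix_x -phiX => E.
by rewrite -addrA -zE; exact: E.
Qed.

(** The kernel of ad w is a subalgebra, so generators suffice. The bracket with a vector of weight -
    lam i would have degree 0 and weight -2 for the coroot, against h^3 = h on g. *)
Lemma plus_layer_centralizes w : plus_layer k.+1 w -> descent_centralizer lam k.+1 w.
Proof.
move=> [Hw fw] y [f [fl ->]]; rewrite linear_sum big1 // => i _.
have ik : (i <= k)%N by rewrite -ltnS.
have [h hi] := coroot_exists F0 grading regular maxA H0A simple_lam lamH0 ik.
have [hA _] := hi; have l2 := lamH0 ik; have lh := coroot_value hi.
change (lie w (f i) = 0); apply/eqP; rewrite -adE -memv_ker; apply: (fl i) => [u v|u].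
  rewrite !memv_ker !adE => /eqP wu /eqP wv.
  by rewrite lie_derivation wu wv lie0l lie0r addr0.
rewrite memv_ker adE => -[ul|ul]; apply/eqP.
  exact: (plus_abelian F0 grading Hw (root_space_eig H0A ul l2)).
have Hu : eig H0 (- 2%:R) u by apply: (root_space_eig H0A ul); rewrite valueN l2.
have hu : eig h (- 2%:R) u by apply: (root_space_eig hA ul); rewrite valueN lh.
have Hwu : eig H0 0 (lie w u) by rewrite /eig -(subrr 2%:R); apply: eig_lie.
have hwu : lie h (lie w u) = - 2%:R *: lie w u.
  by rewrite lie_derivation (fw i (ltn_ord i) h hi) lie0l add0r hu lieZr.
have := coroot_cubic_zero F0 grading H0A lamH0 ik hi Hwu.
rewrite !(hwu, lieZr) => E; apply: (scaler_nat_eq0 F0 (n := 5)).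
by rewrite -[RHS](subrr (- 2%:R *: lie w u)) -[X in _ = _ - X]E; lin_ring.
Qed.

End Motion.

(** * Characteristic zero and irreducibility over the base field *)

Lemma Qp_char0 (p : nat) (K : fieldType) (N : K -> rat) : is_Qp p N -> [pchar K] =i pred0.
Proof.
move=> hK; apply/pcharf0P => n; apply/idP/eqP => [/eqP nK0|->]; last by rewrite eqxx.
have p0 : (p%:R : rat) != 0 by rewrite pnatr_eq0 -lt0n prime_gt0 // (Qp_prime hK).
have := Qp_norm_rat hK n%:R; have -> : ratr n%:R = n%:R :> K.
  by rewrite -[n%:R in LHS]/(n%:~R) ratr_int.
rewrite nK0 ((Qp_norm_eq0 hK 0).2 erefl) /padic_abs pnatr_eq0.
case: eqP => // _ /esym/eqP; rewrite mulf_eq0 invr_eq0 !expf_eq0.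
by rewrite (negPf p0) !andbF.
Qed.

Section Irreducible.
Context (F E : fieldType) (iota : {rmorphism F -> E}) (L : lieType F).
Implicit Types (U V W : {vspace L}).

(** A submodule W over F generates one over E, of the same matrix rank, to which irreducibility over
    E applies. *)
Lemma irreducible_over_base U V W : irreducible_over iota U V -> (W <= V)%VS ->
  (forall z x, z \in U -> x \in W -> lie z x \in W) -> W = 0%VS \/ W = V.
Proof.
move=> [_ irrV] WV stabW.
(* The matrix is square: the rows past \dim W are zero, by the default value of nth. *)
pose M : 'M[F]_(\dim V) := \matrix_(i, j) coord (vbasis V) j (vbasis W)`_i.
have wW i : (vbasis W)`_i \in W.
  case: (ltnP i (\dim W)) => iW; last by rewrite nth_default ?size_tuple ?mem0v.
  by apply/vbasis_mem/mem_nth; rewrite size_tuple.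
have rowE x : x \in W -> (\row_j coord (vbasis V) j x <= M)%MS.
  move=> xW; have dWV := dimvS WV.
  have -> : \row_j coord (vbasis V) j x =
      \sum_(i < \dim W) coord (vbasis W) i x *: row (widen_ord dWV i) M.
    apply/rowP => j; rewrite mxE [in LHS](coord_vbasis xW) linear_sum summxE.
    by apply: eq_bigr => i _; rewrite !mxE linearZ.
  by apply: summx_sub => i _; apply: scalemx_sub; move: (submx_refl M) => /row_subP.
case: (irrV (map_mx iota M)) => [z zU|/eqP|].
- rewrite -map_mxM map_submx; apply/row_subP => i.
  rewrite row_mul; set r := (_ *m _).
  suff -> : r = \row_j coord (vbasis V) j (lie z (vbasis W)`_i).
    by apply: rowE; apply: stabW.
  apply/rowP => j; rewrite !mxE.
  rewrite [in RHS](coord_vbasis (subvP WV _ (wW i))) !linear_sum.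
  by apply: eq_bigr => l _; rewrite !mxE !linearZ.
- rewrite map_mx_eq0 => /eqP M0; left; apply/eqP; rewrite -subv0; apply/subvP => x xW.
  rewrite memv0 (coord_vbasis (subvP WV _ xW)) big1 // => j _.
  have := rowE x xW; rewrite M0 submx0 => /eqP/rowP/(_ j).
  by rewrite !mxE => ->; rewrite scale0r.
rewrite row_full_map => fullM; right; apply/eqP; rewrite eqEsubv WV.
apply/subvP => x xV; have /submxP[d dE] := submx_full (\row_j coord (vbasis V) j x) fullM.
suff -> : x = \sum_i d 0 i *: (vbasis W)`_i.
  by apply: memv_suml => i _; rewrite memvZ.
rewrite (coord_vbasis xV)
  (eq_bigr (fun j => \sum_i (d 0 i * M i j) *: (vbasis V)`_j)).
  rewrite exchange_big; apply: eq_bigr => i _ /=.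
  rewrite [in RHS](coord_vbasis (subvP WV _ (wW i))) scaler_sumr.
  by apply: eq_bigr => j _; rewrite scalerA mxE.
move=> j _; rewrite -scaler_suml; congr (_ *: _).
by have /rowP/(_ j) := dE; rewrite !mxE.
Qed.

End Irreducible.

Section RegularGraded.
Context (F : fieldType) (L : lieType F) (H0 : L).
Context (Fbar : closedFieldType) (iota : {rmorphism F -> Fbar}) (hL : regular_graded H0 iota).

Lemma regular_graded_grading (x : L) : lie H0 (lie H0 (lie H0 x)) = 4%:R *: lie H0 x.
Proof.
have : x \in (Vminus H0 + Vzero H0 + Vplus H0)%VS by rewrite (rg_sum hL) memvf.
case/memv_addP=> [_ /memv_addP[y yV [z zV ->]] [t tV ->]].
have Hy : lie H0 y = - 2%:R *: y by apply/mem_leigenspace.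
have Hz : lie H0 z = 0 *: z by apply/mem_leigenspace.
have Ht : lie H0 t = 2%:R *: t by apply/mem_leigenspace.
by rewrite !(lieDr, lieZr, Hy, Hz, Ht); lin_ring.
Qed.

Lemma regular_graded_irreducible (P : L -> Prop) : linear_pred P ->
  (forall x, P x -> eig H0 2%:R x) ->
  (forall z x, eig H0 0 z -> P x -> P (lie z x)) ->
  (exists2 x, P x & x <> 0) -> forall x, eig H0 2%:R x -> P x.
Proof.
move=> linP PV gP [x Px x0]; have [W WP] := linear_pred_vspace linP.
have WV : (W <= Vplus H0)%VS.
  by apply/subvP => y /WP /PV Hy; apply/mem_leigenspace.
have stabW z y : z \in Vzero H0 -> y \in W -> lie z y \in W.
  by move=> /mem_leigenspace Hz /WP Py; apply/WP/gP.
have [W0|WE] := irreducible_over_base (rg_irreducible hL) WV stabW.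
  by case: x0; apply/eqP; rewrite -memv0 -W0; apply/WP.
by move=> y Hy; apply/WP; rewrite WE; apply/mem_leigenspace.
Qed.

End RegularGraded.

Theorem theorem3p2p2
  (p : nat) (K : fieldType) (N : K -> rat) (hK : is_Qp p N)
  (F : fieldExtType K) (hF : ~ residue_char N F 2)
  (Fbar : closedFieldType) (iota : {rmorphism F -> Fbar})
  (hFbar : is_algebraic_closure iota)
  (L : lieType F) (H0 : L) (hL : regular_graded H0 iota)
  (A : {vspace L}) (hA : max_split_abelian (Vzero H0) A) (hH0 : H0 \in A)
  (Pi : seq 'Hom(subvs_of A, F^o)) (hPi : is_root_basis Pi)
  (hPiH0 : forall nu, nu \in Pi ->
     nu (vsproj A H0) = 0 \/ nu (vsproj A H0) = 2%:R)
  (k : nat) (lam : nat -> 'Hom(subvs_of A, F^o)) (hlam : is_descent H0 Pi lam k) :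
  forall X : L, X \in Vplus H0 ->
    exists2 phi : L -> L, Aut_e (Vzero H0) phi &
      phi X \in (\sum_(i < k.+1) root_space (lam i))%VS.
Proof.
have F0 : [pchar F] =i pred0 by move=> q; rewrite pchar_lalg (Qp_char0 hK).
have grading := regular_graded_grading hL.
have irr := regular_graded_irreducible hL.
have [Im [Ip [/mem_leigenspace HIm /mem_leigenspace HIp tripleI]]] := rg_sl2 hL.
have plus_neq0 : exists2 x : L, eig H0 2%:R x & x <> 0.
  exists (vpick (Vplus H0)); first exact/mem_leigenspace/memv_pick.
  by apply/eqP; rewrite vpick0; apply/eqP/(rg_Vplus_neq0 hL).
have regular := sl2_triple_exists F0 grading HIp HIm tripleI irr plus_neq0.
have [descent stop] := hlam.
have simple_lam j (jk : (j <= k)%N) := (descent j jk).1.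
have lamH0 j (jk : (j <= k)%N) : value (lam j) H0 = 2%:R := (descent j jk).2.
move=> X /mem_leigenspace HX.
have [phi [x [w [Aphi xs Vw phiX]]]] :=
  reduction F0 grading regular hA hH0 hPi hPiH0 simple_lam lamH0 irr (leqnn _) HX.
exists phi => //; rewrite phiX (stop w) ?addr0 //; first by apply/mem_leigenspace; case: Vw.
exact: (plus_layer_centralizes F0 grading regular hA hH0 simple_lam lamH0 Vw).
Qed.
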